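(* Let $R := \max(1, \mathfrak{L}(\phi_0))$, where $\phi_0$ is the true convex regression function. There exists a positive constant $C$ depending only on the ratio $c_1/c_2$ such that $$\mathbb{E}_{\phi_0} \ell^2(\hat{\phi}_{ls}, \phi_0) \leq C \left(\log \frac{en}{2c_1}\right)^{5/4} \min\left[\left(\frac{\sigma^2\sqrt{R}}{n}\right)^{4/5},\ \inf_{\alpha \in \mathcal{P}}\left(\ell^2(\phi_0,\alpha) + \frac{\sigma^2 k^{5/4}(\alpha)}{n}\right)\right]$$ provided $$n \geq C \frac{\sigma^2}{R^2}\left(\log\frac{en}{2c_1}\right)^{5/4}.$$
   Context: Let $\mathcal{C}$ denote the set of all real-valued convex functions on $[0,1]$. Let $n \ge 2$ and let $x_1 < x_2 < \dots < x_n$ be fixed design points in $[0,1]$ satisfying $c_1 \le n(x_i - x_{i-1}) \le c_2$ for $i = 2, \dots, n$, where $c_1, c_2$ are positive constants. We observe $Y_i = \phi_0(x_i) + \xi_i$, $i=1,\dots,n$, where $\phi_0 \in \mathcal{C}$ is unknown and $\xi_1,\dots,\xi_n$ are independent normal random variables with mean zero and variance $\sigma^2 > 0$. $\mathbb{E}_{\phi_0}$ denotes expectation when the true function is $\phi_0$. The least squares estimator $\hat{\phi}_{ls}$ is any minimizer of $\sum_{i=1}^n (Y_i - \psi(x_i))^2$ over $\psi \in \mathcal{C}$ (its values at $x_1,\dots,x_n$ are uniquely determined). For real functions $\phi,\psi$ on $[0,1]$, $\ell^2(\phi,\psi) := \frac1n\sum_{i=1}^n(\phi(x_i)-\psi(x_i))^2$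 and $\ell$ is its nonnegative square root. For $\phi \in \mathcal{C}$, $\mathfrak{L}(\phi) := \inf\{\ell(\phi,\tau) : \tau \text{ is affine on } [0,1]\}$. A convex function $\alpha$ on $[0,1]$ is piecewise affine if there are an integer $k$ and points $0 = t_0 < t_1 < \dots < t_k = 1$ such that $\alpha$ is affine on each interval $[t_{i-1},t_i]$, $i=1,\dots,k$; $k(\alpha)$ is the smallest such $k$, and $k^{5/4}(\alpha) = (k(\alpha))^{5/4}$. $\mathcal{P}$ is the collection of all piecewise affine convex functions on $[0,1]$. *)

(* Defs.v *)
From HB Require Import structures.
From mathcomp Require Import all_boot all_order all_algebra.
From mathcomp Require Import all_classical all_reals all_analysis.

Set Implicit Arguments.
Unset Strict Implicit.
Unset Printing Implicit Defensive.

Import Order.TTheory GRing.Theory Num.Theory.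
Import numFieldNormedType.Exports.

Local Open Scope classical_set_scope.
Local Open Scope ring_scope.

(* Functions on [0,1] are represented by total functions R -> R; nothing below
   depends on their values outside [0,1] (the design points lie in [0,1]). *)

Definition convex01 (R : realType) (f : R -> R) : Prop :=
  @convex_function R R^o `[0, 1]%classic f.

Definition affine_on (R : realType) (D : set R) (f : R -> R) : Prop :=
  exists a b : R, forall z, D z -> f z = a * z + b.

Section DesignPoints.
Context {R : realType} {n : nat}.
Implicit Types (x : 'I_n -> R) (phi psi : R -> R).

Definition ell2 x phi psi : R :=
  n%:R^-1 * \sum_(i < n) (phi (x i) - psi (x i)) ^+ 2.

Definition ell x phi psi : R := Num.sqrt (ell2 x phi psi).

Definition affine_dist x phi : R :=
  inf [set ell x phi tau | tau in [set tau | affine_on `[0, 1]%classic tau]].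

Definition rss x (y : 'I_n -> R) psi : R :=
  \sum_(i < n) (y i - psi (x i)) ^+ 2.

Definition is_lse x (y : 'I_n -> R) psi : Prop :=
  convex01 psi /\ forall chi, convex01 chi -> rss x y psi <= rss x y chi.

End DesignPoints.

Section PiecewiseAffine.
Context {R : realType}.
Implicit Types (k : nat) (f : R -> R).

(* Only t 0, ..., t k matter; k = 0 is excluded by t 0 = 0 and t k = 1. *)
Definition affine_pieces k f : Prop :=
  exists t : nat -> R,
    [/\ t 0%N = 0, t k = 1,
        forall i, (i < k)%N -> t i < t i.+1
      & forall i, (i < k)%N -> affine_on `[t i, t i.+1]%classic f].

Definition pw_affine f : Prop := convex01 f /\ exists k, affine_pieces k f.

(* The default value 0 is only used when f is not piecewise affine. *)
Definition num_pieces f : nat :=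
  xget 0%N [set k | affine_pieces k f /\
                    forall j, affine_pieces j f -> (k <= j)%N].

End PiecewiseAffine.

Section Noise.
Context {d : measure_display} {T : measurableType d} {R : realType}.
Variable P : probability T R.

(* The index set is finite, so the product rule over the full family gives it
   for every subfamily (take A i = setT). *)
Definition independent_RVs (I : finType) (X : I -> {RV P >-> R}) : Prop :=
  forall A : I -> set R, (forall i, measurable (A i)) ->
    P (\bigcap_i (X i @^-1` A i)) = (\prod_i P (X i @^-1` A i))%E.

(* The laws are compared on Borel sets only: distribution P X carries no
   information on the other sets.  The second parameter of normal_prob is the
   standard deviation. *)
Definition normal_RV (m s : R) (X : {RV P >-> R}) : Prop :=
  forall A : set R, measurable A -> distribution P X A = normal_prob m s A.

End Noise.

(* Main.v *)
(* On an index interval, cut into blocks of sizes 1, 2, 4, ..., 4, 2, 1, the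
   slopes of a convex sequence g inside a block of N points are at most of order
   N^(-3/2) times the l^2-norm of g on the block and its two neighbours.  By Abel
   summation, the pairing of g with the noise on a block is then at most that
   norm times the square root of an energy of partial sums of the noise, whose
   mean is of order sigma^2.  An affine piece of alpha involves O(log n) blocks,
   so the basic inequality
     |phi0 - lse|^2 <= |phi0 - alpha|^2 + 2 <xi, lse - alpha>
   bounds the risk by |phi0 - alpha|^2 + sigma^2 k(alpha) log n.
     For the other bound, alpha is phi0 and each block is further cut into m
   pieces.  On a piece lse - phi0 is affine up to the oscillations of the slopes
   of lse and phi0.  These oscillations add up to the one over the block, so the
   remainder involves only the maximum of the normalized partial sums, of order
   sqrt (log n), and decays like m^(-3/2); the optimal m is of order
   (n R^2 / sigma^2)^(1/5). *)

Require Import Defs.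
From HB Require Import structures.
From mathcomp Require Import all_boot all_order all_algebra.
From mathcomp Require Import all_classical all_reals all_analysis.
From mathcomp Require Import measurable_realfun zify ring lra.

Set Implicit Arguments.
Unset Strict Implicit.
Unset Printing Implicit Defensive.

Import Order.TTheory GRing.Theory Num.Theory.
Import numFieldNormedType.Exports.

Local Open Scope classical_set_scope.
Local Open Scope ring_scope.

(** The estimator is given only as some minimizer for each outcome, possibly not measurable in it.
    Every pairing bound is therefore deterministic, and the noise enters only through sums of
    [energy] and one maximum, which have measurable majorants.

    In the second bound [lse - phi0] is a difference of convex sequences, so its slopes are not
    monotone and the buffers say nothing about them directly. The slopes of the two functions are
    bounded separately, after subtracting from both a nearly optimal affine function: oscillations
    do not change, and the norms that bound the slopes become the distance of [phi0] to affine
    functions plus the risk itself, which is absorbed on the left.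

    Slopes are taken with respect to gaps lying between 1 and [K = c2 / c1], so that constants
    depend on this ratio only.

    The number of blocks contributes one power of the logarithm, and 5/4 follows because the
    logarithm is bounded below. The maximum would contribute a second power; the condition on [n]
    makes [m] at least the fourth root of the logarithm, and the decay in [m] then compensates
    it. *)

Ltac nlia := repeat match goal with
  | H : ?P |- _ => lazymatch P with
    | is_true (leq _ _) => fail
    | @eq nat _ _ => fail
    | nat => fail
    | _ => clear H
    end
  end; lia.

(** * Moment generating functions of independent normal variables *)

Section Weighted.
Import HBNNSimple.

(** The indicators determine the integrals of all nonnegative functions, through simple functions
    and monotone convergence. Two uses: [W] a product of functions of the other variables, for
    independence, and [W] a density with [X] the identity, for the normal law. *)
Lemma ge0_integral_weighted (R : realType) (d d' : measure_display)
    (T : measurableType d) (Y : measurableType d')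
    (mu : {measure set T -> \bar R}) (nu : {measure set Y -> \bar R})
    (W : T -> R) (X : T -> Y) :
  measurable_fun [set: T] W -> (forall t, 0 <= W t) -> measurable_fun [set: T] X ->
  (forall A, measurable A ->
     (\int[mu]_t ((W t)%:E * (\1_A (X t))%:E) = nu A)%E) ->
  forall f : Y -> \bar R, measurable_fun [set: Y] f -> (forall y, 0 <= f y)%E ->
  (\int[mu]_t ((W t)%:E * f (X t)) = \int[nu]_y f y)%E.
Proof.
move=> mW W0 mX WX f mf f0.
have mXA (A : set Y) : measurable A -> measurable (X @^-1` A).
  by move=> mA; rewrite -[_ @^-1` _]setTI; exact: mX.
have mWA (A : set Y) : measurable A ->
    measurable_fun [set: T] (fun t => (W t)%:E * (\1_A (X t))%:E)%E.
  move=> mA; apply: emeasurable_funM; apply/measurable_EFinP => //.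
  exact: (measurableT_comp (measurable_indic mA) mX).
have simple (h : {nnsfun Y >-> R}) :
    (\int[mu]_t ((W t)%:E * (h (X t))%:E) = \int[nu]_y (h y)%:E)%E.
  under [RHS]eq_integral do rewrite fimfunE -fsumEFin//.
  rewrite [RHS]ge0_integral_fsum//; last 2 first.
    by move=> r; exact/measurable_EFinP/measurableT_comp.
    by move=> r y _; rewrite EFinM nnfun_muleindic_ge0.
  transitivity (\int[mu]_t (\sum_(r \in range h)
      (r%:E * ((W t)%:E * (\1_(h @^-1` [set r]) (X t))%:E))))%E.
    apply: eq_integral => t _.
    rewrite fimfunE -fsumEFin// ge0_mule_fsumr; last first.
      by move=> r; rewrite EFinM nnfun_muleindic_ge0.
    by apply: eq_fsbigr => r _; rewrite EFinM muleCA.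
  rewrite ge0_integral_fsum//; last 2 first.
    by move=> r; apply: emeasurable_funM => //; exact: mWA.
    move=> r t _; rewrite muleCA mule_ge0 ?lee_fin ?W0//.
    exact: nnfun_muleindic_ge0.
  apply: eq_fsbigr => r _.
  rewrite integralZl_indic_nnsfun// integral_indic// setIT -WX//.
  have [r0|r0] := leP 0 r.
    rewrite ge0_integralZl//; first exact: mWA.
    by move=> t _; rewrite mule_ge0 ?lee_fin ?W0.
  (* A negative [r] is not a value of the nonnegative [h], so both sides vanish. *)
  rewrite preimage_nnfun0//.
  under eq_integral do rewrite indic0 !mule0.
  under [in RHS]eq_integral do rewrite indic0 mule0.
  by rewrite integral0 mule0.
pose f_ := nnsfun_approx measurableT mf.
have ndf t a b : (a <= b)%N -> f_ a t <= f_ b t.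
  by move=> ab; exact/lefP/nd_nnsfun_approx.
have cvf y : (f_ n y)%:E @[n --> \oo] --> f y.
  by apply: (cvg_nnsfun_approx measurableT mf) => // z _; exact: f0.
transitivity (limn (fun n => \int[mu]_t ((W t)%:E * (f_ n (X t))%:E)))%E.
  rewrite -monotone_convergence//.
  - apply: eq_integral => t _; apply/esym/cvg_lim => //.
    by apply: cvgeZl => //; exact: cvf.
  - move=> n; apply: emeasurable_funM; apply/measurable_EFinP => //.
    exact: measurableT_comp.
  - by move=> n t _; rewrite mule_ge0 ?lee_fin ?W0.
  - by move=> t _ a b ab; apply: lee_wpmul2l; rewrite lee_fin ?W0 ?ndf.
transitivity (limn (fun n => \int[nu]_y (f_ n y)%:E))%E.
  by congr (limn _); apply/funext => n; rewrite simple.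
rewrite -monotone_convergence//.
- by apply: eq_integral => t _; exact/cvg_lim.
- by move=> n; exact/measurable_EFinP.
- by move=> n t _; rewrite lee_fin.
- by move=> t _ a b ab; rewrite lee_fin ndf.
Qed.
End Weighted.

Section Indep.
Context {d : measure_display} {T : measurableType d} {R : realType}.
Variable P : probability T R.

(* Starting from indicators, the factors are turned into general functions one
   variable at a time. *)
Lemma independent_integral_prod (n : nat) (X : 'I_n -> {RV P >-> R}) :
  independent_RVs X ->
  forall (f : 'I_n -> R -> R) (v : 'I_n -> R),
  (forall i, measurable_fun [set: R] (f i)) -> (forall i r, 0 <= f i r) ->
  (forall i, \int[P]_w (f i (X i w))%:E = (v i)%:E)%E ->
  (\int[P]_w (\prod_i f i (X i w))%:E = (\prod_i v i)%:E)%E.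
Proof.
move=> iX f v mf f0 fv.
have mXA i (A : set R) : measurable A -> measurable (X i @^-1` A).
  by move=> mA; rewrite -[_ @^-1` _]setTI; exact: measurable_funP.
have v0 i : 0 <= v i.
  by rewrite -lee_fin -fv integral_ge0// => w _; rewrite lee_fin.
(* Hybrid family: coordinates below [k] carry [f], the others an indicator. The induction on [k]
   keeps [A] general so that the set at coordinate [k] can be varied. *)
pose g (k : nat) (A : 'I_n -> set R) (i : 'I_n) : R -> R :=
  if (i < k)%N then f i else \1_(A i).
pose V (k : nat) (A : 'I_n -> set R) (i : 'I_n) : R :=
  if (i < k)%N then v i else fine (P (X i @^-1` A i)).
suff: forall k, (k <= n)%N -> forall A, (forall i, measurable (A i)) ->
    (\int[P]_w (\prod_i g k A i (X i w))%:E = (\prod_i V k A i)%:E)%E.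
  move=> /(_ n (leqnn n) (fun=> setT) (fun=> measurableT)) H.
  transitivity (\int[P]_w (\prod_i g n (fun=> setT) i (X i w))%:E)%E.
    apply: eq_integral => w _; congr EFin; apply: eq_bigr => i _.
    by rewrite /g ltn_ord.
  by rewrite H; congr EFin; apply: eq_bigr => i _; rewrite /V ltn_ord.
elim=> [|k IH] kn A mA.
  transitivity (\int[P]_w (\1_(\bigcap_i (X i @^-1` A i)) w)%:E)%E.
    apply: eq_integral => w _; congr EFin.
    rewrite /g /= indicE; have [/set_mem wA|/negP wA] := boolP (_ \in _).
      rewrite big1// => i _; rewrite indicE mem_set//; exact: wA.
    have [i Ai] : exists i, ~ A i (X i w).
      by apply/existsNP => H; apply: wA; apply/mem_set => i _; exact: H.
    by rewrite (bigD1 i)//= indicE memNset// mul0r.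
  rewrite integral_indic ?setIT//; last first.
    by apply: fin_bigcap_measurable => // i _; exact: mXA.
  apply: etrans (iX A mA) _; rewrite -prodEFin; apply: eq_bigr => i _.
  by rewrite /V /= fineK// fin_num_measure//; exact: mXA.
pose j : 'I_n := Ordinal kn.
have ltSk (i : 'I_n) : i != j -> (i < k.+1)%N = (i < k)%N.
  move=> ij; rewrite ltnS [LHS]leq_eqVlt.
  by have -> : (i == k :> nat) = false by exact: negbTE ij.
have mg A' i : (forall i, measurable (A' i)) -> measurable_fun [set: R] (g k A' i).
  by move=> mA'; rewrite /g; case: ifP => // _; exact: measurable_indic.
pose W (w : T) := \prod_(i | i != j) g k A i (X i w).
pose c := \prod_(i | i != j) V k A i.
have c0 : 0 <= c.
  by apply: prodr_ge0 => i _; rewrite /V; case: ifP => // _; exact: fine_ge0.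
have g0 k' A' i r : 0 <= g k' A' i r.
  by rewrite /g; case: ifP => // _; rewrite indicE.
have W0 w : 0 <= W w by exact: prodr_ge0.
have mW : measurable_fun [set: T] W.
  rewrite (_ : W = fun w => \prod_(i <- [seq i <- index_enum 'I_n | i != j])
      g k A i (X i w)); last by apply/funext => w; rewrite big_filter.
  apply: measurable_prod => i _; apply: measurableT_comp; first exact: mg.
  exact: measurable_funP.
(* The induction hypothesis with the set at [j] replaced by [B]: under the weight [W], the law of
   [X j] is [c] times its law under [P]. *)
have key (B : set R) : measurable B ->
    (\int[P]_w ((W w)%:E * (\1_B (X j w))%:E) =
     mscale (NngNum c0) (distribution P (X j)) B)%E.
  move=> mB; pose A' i := if i == j then B else A i.
  have mA' i : measurable (A' i) by rewrite /A'; case: ifP.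
  have := IH (ltnW kn) A' mA'.
  rewrite (bigD1 j)//= {1}/V ltnn /A' eqxx => H.
  transitivity (\int[P]_w (\prod_i g k A' i (X i w))%:E)%E.
    apply: eq_integral => w _; rewrite -EFinM; congr EFin.
    rewrite (bigD1 j)//= mulrC; congr (_ * _).
      by rewrite /g ltnn /A' eqxx.
    by apply: eq_bigr => i ij; rewrite /g /A' (negbTE ij).
  rewrite H mulrC EFinM /mscale /=; congr (_ * _)%E.
    congr EFin; apply: eq_bigr => i ij; by rewrite /V (negbTE ij).
  by rewrite fineK// fin_num_measure//; exact: mXA.
have := ge0_integral_weighted mW W0 (measurable_funP (X j)) key.
move=> /(_ (fun r => (f j r)%:E)) H.
transitivity (\int[P]_w ((W w)%:E * (f j (X j w))%:E))%E.
  apply: eq_integral => w _; rewrite -EFinM; congr EFin.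
  rewrite (bigD1 j)//= mulrC; congr (_ * _).
    by apply: eq_bigr => i ij; rewrite /g ltSk.
  by rewrite /g ltnSn.
rewrite H; last 2 first.
- exact/measurable_EFinP.
- by move=> r; rewrite lee_fin.
rewrite ge0_integral_mscale//; last 2 first.
- exact/measurable_EFinP.
- by move=> r _; rewrite lee_fin.
rewrite ge0_integral_pushforward//; last 2 first.
- exact/measurable_EFinP.
- by move=> r _; rewrite lee_fin.
rewrite fv -EFinM; congr EFin.
rewrite (bigD1 j)//= mulrC; congr (_ * _).
  by rewrite /V ltnSn.
by apply: eq_bigr => i ij; rewrite /V ltSk.
Qed.
End Indep.

Section Normal.
Context {d : measure_display} {T : measurableType d} {R : realType}.
Variable P : probability T R.

(** Completing the square: an exponential tilt of a centred normal density shifts its mean. *)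
Lemma expR_normal_pdf (a s x : R) : s != 0 ->
  normal_pdf 0 s x * expR (a * x) =
  expR (a ^+ 2 * s ^+ 2 / 2) * normal_pdf (a * s ^+ 2) s x.
Proof.
move=> s0; rewrite !normal_pdfE// /normal_fun mulrCA -!mulrA.
congr (_ * _); rewrite -!expRD; congr expR.
rewrite subr0; field.
by rewrite s0.
Qed.

Lemma normal_mgf (a s : R) (X : {RV P >-> R}) : s != 0 -> normal_RV 0 s X ->
  (\int[P]_w (expR (a * X w))%:E = (expR (a ^+ 2 * s ^+ 2 / 2))%:E)%E.
Proof.
move=> s0 nX.
have mexp : measurable_fun [set: R] (fun x : R => (expR (a * x))%:E).
  by apply/measurable_EFinP; apply: measurableT_comp => //; exact: mulrl_measurable.
transitivity (\int[distribution P X]_x (expR (a * x))%:E)%E.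
  by rewrite ge0_integral_pushforward// => x _; rewrite lee_fin expR_ge0.
have weighted := @ge0_integral_weighted R _ _ _ _ lebesgue_measure
   (distribution P X) (normal_pdf 0 s) id.
rewrite -weighted//; last 3 first.
- exact: measurable_normal_pdf.
- by move=> x; exact: normal_pdf_ge0.
- move=> A mA; apply: etrans _ (esym (nX A mA)).
  rewrite /normal_prob [RHS]integral_mkcond.
  apply: eq_integral => x _; rewrite patchE indicE.
  by case: ifP => _; rewrite ?mule1 ?mule0.
transitivity (\int[lebesgue_measure]_x ((expR (a ^+ 2 * s ^+ 2 / 2))%:E *
   (normal_pdf (a * s ^+ 2) s x)%:E))%E.
  by apply: eq_integral => x _; rewrite -!EFinM expR_normal_pdf.
rewrite ge0_integralZl//; last 2 first.
- by apply/measurable_EFinP; exact: measurable_normal_pdf.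
- by move=> x _; rewrite lee_fin normal_pdf_ge0.
by rewrite integral_normal_pdf mule1.
Qed.

Lemma independent_normal_mgf (n : nat) (X : 'I_n -> {RV P >-> R}) (s : R)
    (D : pred 'I_n) (a : R) : s != 0 -> independent_RVs X ->
  (forall i, normal_RV 0 s (X i)) ->
  (\int[P]_w (expR (a * \sum_(i | D i) X i w))%:E =
   (expR (a ^+ 2 * s ^+ 2 / 2 *+ #|D|))%:E)%E.
Proof.
move=> s0 iX nX.
(* Indices outside [D] get the factor 1, so that the product rule for the full family applies. *)
pose f (i : 'I_n) (x : R) : R := if D i then expR (a * x) else 1.
transitivity (\int[P]_w (\prod_i f i (X i w))%:E)%E.
  apply: eq_integral => w _; congr EFin.
  by rewrite mulr_sumr expR_sum big_mkcond.
rewrite (independent_integral_prod iX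
  (v := fun i => if D i then expR (a ^+ 2 * s ^+ 2 / 2) else 1)).
- by rewrite -sumr_const expR_sum [in RHS]big_mkcond.
- move=> i; rewrite /f; case: (D i) => //.
  by apply: measurableT_comp => //; exact: mulrl_measurable.
- by move=> i r; rewrite /f; case: ifP => // _; exact: expR_ge0.
- move=> i; rewrite /f; case: ifP => _; first exact: normal_mgf.
  by rewrite integral_cst// mul1e; exact: probability_setT.
Qed.
End Normal.

(** * Mean bounds for functions that may fail to be measurable *)

Section MeanLe.
Context {d : measure_display} {T : measurableType d} {R : realType}.
Variable P : probability T R.

(* An upper bound on the mean of a function that need not be measurable: the
   least squares estimator depends on the noise in an arbitrary way. *)
Definition mean_le (f : T -> R) (v : R) : Prop :=
  exists g : T -> R, [/\ measurable_fun [set: T] g, forall w, 0 <= g w,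
    forall w, f w <= g w & (\int[P]_w (g w)%:E <= v%:E)%E].

Lemma mean_leW (f f' : T -> R) (v v' : R) :
  (forall w, f w <= f' w) -> v' <= v -> mean_le f' v' -> mean_le f v.
Proof.
move=> ff' vv' [g [mg g0 fg gv]]; exists g; split => //.
  by move=> w; exact: le_trans (fg w).
by apply: le_trans gv _; rewrite lee_fin.
Qed.

Lemma mean_le_cst (c : R) : 0 <= c -> mean_le (fun=> c) c.
Proof.
move=> c0; exists (fun=> c); split => //.
rewrite integral_cst// [X in (_ * X)%E](_ : _ = 1%E) ?mule1//.
exact: probability_setT.
Qed.

Lemma mean_leD (f f' : T -> R) (v v' : R) :
  mean_le f v -> mean_le f' v' -> mean_le (fun w => f w + f' w) (v + v').
Proof.
move=> [g [mg g0 fg gv]] [g' [mg' g'0 fg' gv']].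
exists (fun w => g w + g' w); split.
- exact: measurable_funD.
- by move=> w; rewrite addr_ge0.
- by move=> w; rewrite lerD.
under eq_integral do rewrite EFinD.
rewrite ge0_integralD//.
- by rewrite EFinD leeD.
- by move=> w _; rewrite lee_fin.
- exact/measurable_EFinP.
- by move=> w _; rewrite lee_fin.
- exact/measurable_EFinP.
Qed.

Lemma mean_leZ (f : T -> R) (v c : R) :
  0 <= c -> mean_le f v -> mean_le (fun w => c * f w) (c * v).
Proof.
move=> c0 [g [mg g0 fg gv]]; exists (fun w => c * g w); split.
- exact: measurable_funM.
- by move=> w; rewrite mulr_ge0.
- by move=> w; rewrite ler_wpM2l.
under eq_integral do rewrite EFinM.
rewrite ge0_integralZl//.
- by rewrite EFinM lee_wpmul2l.
- exact/measurable_EFinP.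
- by move=> w _; rewrite lee_fin.
Qed.

Lemma mean_le_sum (I : Type) (r : seq I) (D : pred I) (f : I -> T -> R)
    (v : I -> R) : (forall i, D i -> mean_le (f i) (v i)) ->
  mean_le (fun w => \sum_(i <- r | D i) f i w) (\sum_(i <- r | D i) v i).
Proof.
move=> fv; elim: r => [|i r IH].
  rewrite big_nil; apply: mean_leW (mean_le_cst (lexx 0)) => // w.
  by rewrite big_nil.
rewrite big_cons; case: ifPn => Di.
  apply: mean_leW (mean_leD (fv i Di) IH) => // w.
  by rewrite big_cons Di.
by apply: mean_leW IH => // w; rewrite big_cons (negbTE Di).
Qed.

(** The integral of a nonnegative function is a supremum over the simple functions below it, hence
    monotone without any measurability. *)
Lemma mean_le_expectation (f : T -> R) (v : R) :
  (forall w, 0 <= f w) -> mean_le f v -> ('E_P[f] <= v%:E)%E.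
Proof.
move=> f0 [g [mg g0 fg gv]]; apply: le_trans gv; rewrite unlock.
rewrite !ge0_integralTE; last 2 first.
- by move=> w; rewrite lee_fin.
- by move=> w; rewrite lee_fin.
apply: le_ereal_sup => _ [h hf <-]; exists h => // w.
by apply: le_trans (hf w) _; rewrite lee_fin.
Qed.

End MeanLe.

(** * Pairing the noise with convex sequences *)

Section Blocks.
Context {R : realType}.
Implicit Types (f g e : nat -> R) (p q h i j l : nat).

(** Young's inequality with a free weight [c]. *)
Lemma mul_le_sqrD (x t c : R) : 0 < c -> x * t <= c * x ^+ 2 + t ^+ 2 / (4 * c).
Proof.
move=> c0; have : 0 <= (2 * c * x - t) ^+ 2 by exact: sqr_ge0.
have -> : (2 * c * x - t) ^+ 2 = 4 * c * (c * x ^+ 2 + t ^+ 2 / (4 * c) - x * t).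
  by field; rewrite gt_eqF.
by rewrite pmulr_rge0 ?subr_ge0// mulr_gt0.
Qed.

Definition nrm2 f p q : R := \sum_(p <= i < q) f i ^+ 2.

Lemma nrm2_ge0 f p q : 0 <= nrm2 f p q.
Proof. by apply: sumr_ge0 => i _; exact: sqr_ge0. Qed.

Lemma nrm2_cat f p q r : (p <= q)%N -> (q <= r)%N ->
  nrm2 f p r = nrm2 f p q + nrm2 f q r.
Proof. by move=> pq qr; rewrite /nrm2 (big_cat_nat pq qr). Qed.

Lemma nrm2_sub f p q p' q' : (p' <= p)%N -> (q <= q')%N ->
  nrm2 f p q <= nrm2 f p' q'.
Proof.
move=> pp qq; have [pq|qp] := leqP p q; last first.
  by rewrite {1}/nrm2 big_geq ?(ltnW qp)// nrm2_ge0.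
rewrite (nrm2_cat f pp (leq_trans pq qq)) (nrm2_cat f pq qq).
have := nrm2_ge0 f p' p; have := nrm2_ge0 f q q'; lra.
Qed.

Lemma nrm2_addl f g p q : nrm2 (fun i => f i + g i) p q <=
  2 * nrm2 f p q + 2 * nrm2 g p q.
Proof.
rewrite /nrm2 !mulr_sumr -big_split /=; apply: ler_sum => i _.
have := sqr_ge0 (f i - g i); nra.
Qed.

(** The [h] pairs of points [i], [i + h] are disjoint, and two values that differ by [h * a] have
    squares adding up to at least half of [(h * a) ^+ 2]. This is the origin of the exponent 3: a
    slope [a] over a length [h] costs [h ^+ 3 * a ^+ 2] in squared norm. *)
Lemma sqr_diff_sum_le f p q h a : 0 <= a -> (p + h + h <= q)%N ->
  (forall i, (p <= i < p + h)%N -> h%:R * a <= `|f (i + h)%N - f i|) ->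
  h%:R ^+ 3 * a ^+ 2 <= 2 * nrm2 f p q.
Proof.
move=> a0 hq H.
have sumh : \sum_(p <= i < p + h) (h%:R * a) ^+ 2 = h%:R ^+ 3 * a ^+ 2.
  by rewrite sumr_const_nat addKn -mulr_natl; ring.
have split2 : nrm2 f p (p + h + h) =
    \sum_(p <= i < p + h) (f i ^+ 2 + f (i + h)%N ^+ 2).
  rewrite (@nrm2_cat _ p (p + h)) ?leq_addr// big_split /=. congr +%R.
  by rewrite /nrm2 big_addn addnK.
rewrite -sumh; apply: le_trans (_ : _ <= 2 * nrm2 f p (p + h + h)) _; last first.
  by rewrite ler_wpM2l// nrm2_sub.
rewrite split2 mulr_sumr; apply: ler_sum_nat => i ip.
have := H i ip => H1; have h0 : 0 <= h%:R * a by rewrite mulr_ge0.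
have : (h%:R * a) ^+ 2 <= (f (i + h)%N - f i) ^+ 2.
  by rewrite -(real_normK (num_real (f _ - _))) ler_sqr ?nnegrE.
have := sqr_ge0 (f (i + h)%N + f i); nra.
Qed.

Lemma abel_sum f e p N :
  \sum_(p <= i < p + N.+1) f i * e i =
  f p * \sum_(p <= l < p + N.+1) e l +
  \sum_(p <= i < p + N) (f i.+1 - f i) * \sum_(i.+1 <= l < p + N.+1) e l.
Proof.
elim: N p => [|N IH] p.
  by rewrite addn1 !big_nat1 addn0 big_geq ?addr0.
have -> : (p + N.+2 = p.+1 + N.+1)%N by lia.
have -> : (p + N.+1 = p.+1 + N)%N by lia.
have ltq : (p < p.+1 + N.+1)%N by lia.
have ltp : (p < p.+1 + N)%N by lia.
rewrite (big_ltn ltq) IH [in RHS](big_ltn ltq) [in RHS](big_ltn ltp).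
ring.
Qed.

(* By Abel summation this controls the pairing of the noise with a function
   whose slopes are bounded. *)
Definition tails e p q : R :=
  (q - p)%:R * `|\sum_(p <= l < q) e l| +
  \sum_(p <= i < q) `|\sum_(i <= l < q) e l|.

Lemma tails_ge0 e p q : 0 <= tails e p q.
Proof. by rewrite addr_ge0 ?mulr_ge0// sumr_ge0. Qed.

Variables (gap : nat -> R) (K : R).
Hypothesis gapK : forall i, 1 <= gap i <= K.

Let gap1 i : 1 <= gap i. Proof. by have /andP[] := gapK i. Qed.
Let gapleK i : gap i <= K. Proof. by have /andP[] := gapK i. Qed.
Let gap0 i : 0 < gap i. Proof. exact: lt_le_trans ltr01 (gap1 i). Qed.
Let K1 : 1 <= K. Proof. exact: le_trans (gap1 0) (gapleK 0). Qed.
Let K0 : 0 <= K. Proof. exact: le_trans ler01 K1. Qed.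

Lemma sum_ge_nat (F : nat -> R) p h c :
  (forall i, (p <= i < p + h)%N -> c <= F i) -> h%:R * c <= \sum_(p <= i < p + h) F i.
Proof.
move=> H; rewrite mulr_natl -{1}(addKn p h) -sumr_const_nat.
exact: ler_sum_nat.
Qed.

(** Abel summation bounds the pairing by [tails] times the size of [g p / N] and of the slopes. The
    norm of [g] controls both up to multiples of [delta]: a slope beyond [delta] separates distant
    values, and a value at [p] beyond the total change of [g] persists over the whole interval.
    Young's inequality then separates the norm from the noise. *)
Lemma almost_affine_pairing g e p q (a0 delta eps : R) :
  (p < q)%N -> 0 <= delta -> 0 < eps ->
  (forall i, (p <= i)%N -> (i.+1 < q)%N ->
     `|g i.+1 - g i - gap i * a0| <= gap i * delta) ->
  `|\sum_(p <= i < q) g i * e i| <= eps * nrm2 g p q +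
    109 * K ^+ 2 / eps * (tails e p q ^+ 2 / (q - p)%:R ^+ 3) +
    4 * K * delta * tails e p q.
Proof.
move=> pq delta0 eps0.
(* A single point has no slope; taking [a0 = 0] there makes [aQ] below true also for [N = 1]. *)
wlog a00 : a0 / (q = p.+1 -> a0 = 0).
  move=> WL H; have [qp|qp] := eqVneq q p.+1.
    apply: (WL 0) => // i pi iq; exfalso; lia.
  apply: (WL a0) => // qp'; by rewrite qp' eqxx in qp.
have [N qE] : exists N, q = (p + N)%N by exists (q - p)%N; lia.
rewrite {q}qE addKn in pq a00 *; move=> H.
have N0 : (0 < N)%N by lia.
have NR0 : 0 < N%:R :> R by rewrite ltr0n.
set Q := nrm2 g p (p + N); have Q0 : 0 <= Q := nrm2_ge0 _ _ _.
set t := tails e p (p + N); have t0 : 0 <= t := tails_ge0 _ _ _.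
have step i : (p <= i)%N -> (i.+1 < p + N)%N ->
    `|g i.+1 - g i| <= K * (`|a0| + delta).
  move=> pi iq; have := H i pi iq.
  have := ler_normD (g i.+1 - g i - gap i * a0) (gap i * a0).
  rewrite subrK normrM (gtr0_norm (gap0 i)).
  have := gapleK i; have := normr_ge0 a0; nra.
have pairing : `|\sum_(p <= i < p + N) g i * e i| <=
    (`|g p| / N%:R + K * (`|a0| + delta)) * t.
  have [M ME] : exists M, N = M.+1 by exists N.-1; clear -N0; lia.
  rewrite ME abel_sum; apply: le_trans (ler_normD _ _) _.
  rewrite mulrDl; apply: lerD.
    rewrite normrM -mulrA ler_wpM2l//.
    rewrite ler_pdivlMl// /t /tails ME addKn.
    by rewrite lerDl sumr_ge0.
  apply: le_trans (ler_norm_sum _ _ _) _.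
  apply: le_trans (_ : _ <= \sum_(p <= i < p + M) K * (`|a0| + delta) *
      `|\sum_(i.+1 <= l < p + M.+1) e l|) _.
    apply: ler_sum_nat => i /andP[pi iM]; rewrite normrM ler_wpM2r//.
    by apply: step; [exact: pi | clear -pi iM ME; lia].
  rewrite -mulr_sumr ler_wpM2l ?mulr_ge0 ?addr_ge0//.
  rewrite /t /tails; apply: (@le_trans _ _ (\sum_(p <= i < p + N) `|\sum_(i <= l < p + N) e l|)).
    rewrite ME addnS big_nat_recl ?leq_addr//= lerDr.
    exact: normr_ge0.
  by rewrite lerDr mulr_ge0.
(* The part of the slope that [delta] does not account for. *)
pose a := Num.max 0 (`|a0| - delta).
have a_ge0 : 0 <= a by rewrite /a le_max lexx.
have a0a : `|a0| <= a + delta by rewrite -lerBlDr /a le_max lexx orbT.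
have aQ : N%:R ^+ 3 * a ^+ 2 <= 54 * Q.
  have [N1|N2] := leqP N 1.
    rewrite /a a00; last by clear -N0 N1; lia.
    rewrite normr0 sub0r max_l ?oppr_le0// expr0n mulr0.
    by rewrite mulr_ge0.
  (* As [N >= 2], one has [N <= 3 * h]; the constant 54 is [3 ^ 3] times the 2 of
     [sqr_diff_sum_le]. *)
  pose h := (N %/ 2)%N.
  have hN : (N <= 3 * h)%N by rewrite /h; clear -N2; lia.
  have hhq : (p + h + h <= p + N)%N by rewrite /h; clear; lia.
  have h3 : h%:R ^+ 3 * a ^+ 2 <= 2 * Q.
    apply: (@sqr_diff_sum_le _ _ _ h) => //.
    move=> i /andP[pi ih]; rewrite /a.
    have [ad|ad] := leP (`|a0| - delta) 0.
      by rewrite mulr0 normr_ge0.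
    pose G : R := \sum_(i <= l < i + h) gap l.
    have Gh : h%:R * 1 <= G by apply: sum_ge_nat => l _.
    have : `|g (i + h)%N - g i - G * a0| <= G * delta.
      rewrite /G -telescope_sumr ?leq_addr// !mulr_suml -sumrB.
      apply: le_trans (ler_norm_sum _ _ _) _; apply: ler_sum_nat => l /andP[il lh].
      by apply: H; clear -pi il ih lh hhq; lia.
    have := ler_normD (G * a0 - (g (i + h)%N - g i)) (g (i + h)%N - g i).
    rewrite subrK normrM -[`|G * a0 - _|]normrN opprB.
    have G0 : 0 <= G by apply: le_trans Gh; rewrite mulr1.
    rewrite (ger0_norm G0) => H1 H2.
    apply: le_trans (_ : G * (`|a0| - delta) <= _); last by lra.
    by rewrite ler_wpM2r ?(ltW ad)//; lra.
  have hN3 : N%:R ^+ 3 <= (3 * h%:R) ^+ 3 :> R.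
    by rewrite -natrM lerXn2r ?nnegrE// ler_nat.
  have := sqr_ge0 a; nra.
(* What is left of [g p] after the largest possible change of [g]: all values on the interval are at
   least [b] in absolute value. *)
pose b := Num.max 0 (`|g p| - K * N%:R * (a + 2 * delta)).
have b_ge0 : 0 <= b by rewrite /b le_max lexx.
have gpb : `|g p| <= b + K * N%:R * (a + 2 * delta).
  by rewrite -lerBlDr /b le_max lexx orbT.
have bQ : N%:R * b ^+ 2 <= Q.
  rewrite /Q /nrm2; apply: sum_ge_nat => i /andP[pi iN].
  rewrite -(real_normK (num_real (g i))) ler_sqr ?nnegrE//.
  rewrite /b ge_max normr_ge0 /= lerBlDr.
  have : `|g i - g p| <= N%:R * (K * (`|a0| + delta)).
    rewrite -telescope_sumr//; apply: le_trans (ler_norm_sum _ _ _) _.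
    apply: le_trans (_ : _ <= \sum_(p <= l < i) K * (`|a0| + delta)) _.
      by apply: ler_sum_nat => l /andP[pl li]; apply: step; [exact: pl | clear -pi iN pl li; lia].
    rewrite sumr_const_nat -[leLHS]mulr_natl ler_wpM2r ?mulr_ge0 ?addr_ge0//.
    by rewrite ler_nat; clear -pi iN; lia.
  have := ler_normD (g p - g i) (g i); rewrite subrK -[`|g p - _|]normrN opprB.
  have : K * N%:R * (`|a0| + delta) <= K * N%:R * (a + 2 * delta).
    by rewrite ler_wpM2l ?mulr_ge0//; lra.
  lra.
apply: le_trans pairing _.
have coef : `|g p| / N%:R + K * (`|a0| + delta) <= b / N%:R + 2 * K * a + 4 * K * delta.
  have : `|g p| / N%:R <= b / N%:R + K * (a + 2 * delta).
    rewrite ler_pdivrMr// mulrDl divfK ?gt_eqF//; lra.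
  have : K * (`|a0| + delta) <= K * (a + 2 * delta) by rewrite ler_wpM2l//; lra.
  lra.
apply: le_trans (ler_wpM2r t0 coef) _; rewrite mulrDl lerD2r mulrDl.
pose y := t ^+ 2 / N%:R ^+ 3.
have N3 : 0 < N%:R ^+ 3 :> R by rewrite exprn_gt0.
have y0 : 0 <= y by rewrite /y divr_ge0 ?sqr_ge0// ltW.
have amgm (x c : R) : 0 < c -> x * t <= c * N%:R ^+ 3 * x ^+ 2 + y / (4 * c).
  move=> c0; have := @mul_le_sqrD x t (c * N%:R ^+ 3).
  have -> : y / (4 * c) = t ^+ 2 / (4 * (c * N%:R ^+ 3)).
    by rewrite /y; field; rewrite !gt_eqF.
  by apply; rewrite mulr_gt0.
have b1 : b / N%:R * t <= eps / 2 * Q + y / (2 * eps).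
  have := @amgm (b / N%:R) (eps / 2).
  have -> : eps / 2 * N%:R ^+ 3 * (b / N%:R) ^+ 2 = eps / 2 * (N%:R * b ^+ 2).
    by field; rewrite gt_eqF.
  have -> : 4 * (eps / 2) = 2 * eps by field.
  move=> H1; have {}H1 := H1 ltac:(lra); apply: le_trans H1 _; rewrite lerD2r.
  by rewrite ler_wpM2l//; lra.
have K21 : 1 <= K ^+ 2 by rewrite exprn_ege1.
have a1 : 2 * K * a * t <= eps / 2 * Q + 108 * K ^+ 2 * y / eps.
  have Kp : 0 < K := lt_le_trans ltr01 K1.
  have := @amgm (2 * K * a) (eps / (432 * K ^+ 2)).
  have -> : eps / (432 * K ^+ 2) * N%:R ^+ 3 * (2 * K * a) ^+ 2 =
     eps / 108 * (N%:R ^+ 3 * a ^+ 2) by field; rewrite gt_eqF.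
  have -> : y / (4 * (eps / (432 * K ^+ 2))) = 108 * K ^+ 2 * y / eps.
    by field; rewrite !gt_eqF.
  have c0 : 0 < eps / (432 * K ^+ 2) by apply: divr_gt0; [exact: eps0 | lra].
  move=> /(_ c0) H1; apply: le_trans H1 _; rewrite lerD2r.
  have -> : eps / 2 * Q = eps / 108 * (54 * Q) by field.
  by apply: ler_wpM2l; [lra | exact: aQ].
rewrite -/y.
have : y / (2 * eps) + 108 * K ^+ 2 * y / eps <= 109 * K ^+ 2 / eps * y.
  have -> : y / (2 * eps) + 108 * K ^+ 2 * y / eps = (1 / 2 + 108 * K ^+ 2) * (y / eps).
    by field; rewrite gt_eqF.
  have -> : 109 * K ^+ 2 / eps * y = 109 * K ^+ 2 * (y / eps).
    by field; rewrite gt_eqF.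
  apply: ler_wpM2r; [by apply: divr_ge0 => //; exact: ltW | lra].
lra.
Qed.

(** * Slopes of convex sequences and Whitney blocks *)

Definition slope f i : R := (f i.+1 - f i) / gap i.

Definition slopes_nondecreasing f p q : Prop :=
  forall i j, (p <= i)%N -> (i <= j)%N -> (j.+1 < q)%N -> slope f i <= slope f j.

Lemma slopeE f i : f i.+1 - f i = gap i * slope f i.
Proof. by rewrite /slope mulrC divfK// gt_eqF. Qed.

Lemma slopes_nondecreasingS f p q p' q' : (p' <= p)%N -> (q <= q')%N ->
  slopes_nondecreasing f p' q' -> slopes_nondecreasing f p q.
Proof. by move=> pp qq H i j pi ij jq; apply: H => //; nlia. Qed.

(** A nonnegative slope at [l] forces slopes at least as large on the right buffer, a negative one
    forces slopes at least as steep on the left buffer; there [sqr_diff_sum_le] applies with [h]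
    about half the buffer. Then [16 * h] is at least the block length, and [2 ^ 13] is
    [2 * 16 ^ 3]. *)
Lemma slope_sqr_le f p0 p1 p2 p3 l :
  (p0 < p1)%N -> (p1 <= l)%N -> (l.+1 < p2)%N -> (p2 < p3)%N ->
  (p2 - p1 <= 8 * (p1 - p0))%N -> (p2 - p1 <= 8 * (p3 - p2))%N ->
  slopes_nondecreasing f p0 p3 ->
  (p2 - p1)%:R ^+ 3 * slope f l ^+ 2 <= 2 ^+ 13 * nrm2 f p0 p3.
Proof.
move=> p01 p1l lp2 p23 r1 r2 cf.
have fin (h : nat) : (p2 - p1 <= 16 * h)%N ->
    h%:R ^+ 3 * `|slope f l| ^+ 2 <= 2 * nrm2 f p0 p3 ->
    (p2 - p1)%:R ^+ 3 * slope f l ^+ 2 <= 2 ^+ 13 * nrm2 f p0 p3.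
  rewrite real_normK ?num_real// => hN H.
  have hN3 : (p2 - p1)%:R ^+ 3 <= (16 * h%:R) ^+ 3 :> R.
    by rewrite -natrM lerXn2r ?nnegrE// ler_nat.
  apply: le_trans (ler_wpM2r (sqr_ge0 _) hN3) _.
  rewrite (_ : 2 ^+ 13 * _ = 16 ^+ 3 * (2 * nrm2 f p0 p3)); last by ring.
  by rewrite exprMn -mulrA ler_wpM2l// exprn_ge0.
have [s0|s0] := leP 0 (slope f l).
  pose h := ((p3 - p2).+1 %/ 2)%N.
  apply: (fin h); first by rewrite /h; nlia.
  apply: le_trans (_ : _ <= 2 * nrm2 f p2.-1 p3) _; last first.
    by rewrite ler_wpM2l// nrm2_sub//; nlia.
  apply: sqr_diff_sum_le => //; first by rewrite /h; nlia.
  move=> i /andP[pi ih]; rewrite (ger0_norm s0).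
  apply: le_trans (ler_norm _); rewrite -telescope_sumr ?leq_addr//.
  apply: sum_ge_nat => j /andP[ij ji]; rewrite slopeE.
  have : slope f l <= slope f j by apply: cf => //; rewrite /h in ih ji; nlia.
  have := gap1 j; nra.
pose h := ((p1 - p0).+1 %/ 2)%N.
apply: (fin h); first by rewrite /h; nlia.
apply: le_trans (_ : _ <= 2 * nrm2 f p0 p1.+1) _; last first.
  by rewrite ler_wpM2l// nrm2_sub//; nlia.
apply: le_trans (_ : _ <= 2 * nrm2 f (p1.+1 - (h + h)) p1.+1) _; last first.
  by rewrite ler_wpM2l// nrm2_sub//; rewrite /h; nlia.
apply: sqr_diff_sum_le => //; first by rewrite /h; nlia.
move=> i /andP[pi ih]; rewrite (ltr0_norm s0) -normrN opprB.
apply: le_trans (ler_norm _).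
rewrite -opprB -telescope_sumr ?leq_addr// -sumrN.
apply: sum_ge_nat => j /andP[ij ji]; rewrite slopeE.
have : slope f j <= slope f l by apply: cf => //; rewrite /h in pi ih ji; nlia.
have := gap1 j; nra.
Qed.

Lemma sum_cuts (c : nat -> nat) k (F : nat -> R) : (forall i, (c i <= c i.+1)%N) ->
  \sum_(0 <= i < k) \sum_(c i <= l < c i.+1) F l = \sum_(c 0 <= l < c k) F l.
Proof.
move=> mc; have c0k j : (c 0 <= c j)%N.
  by elim: j => // j IH; exact: leq_trans IH (mc j).
elim: k => [|k IH]; first by rewrite !big_geq.
by rewrite big_nat_recr//= IH -big_cat_nat.
Qed.

(* The two neighbours of a block serve as buffers: there convexity bounds the
   slopes inside the block by the size of the function. *)
Definition whitney a b k (c : nat -> nat) : Prop :=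
  [/\ c 0%N = a, forall i, (k <= i)%N -> c i = b,
      forall i, (c i <= c i.+1)%N &
      forall i, (i < k)%N -> (1 < c i.+1 - c i)%N ->
        [/\ (0 < i)%N, (c i.+1 - c i <= 8 * (c i - c i.-1))%N &
            (c i.+1 - c i <= 8 * (c i.+2 - c i.+1))%N]].

(* The block sizes are 1, 2, 4, ..., M, ..., 4, 2, 1. *)
Lemma whitney_exists a N :
  exists c, whitney a (a + N) (2 * trunc_log 2 N + 3) c.
Proof.
case: N => [|N].
  exists (fun=> a); split => //; [by rewrite addn0|by move=> i _; rewrite subnn].
(* The side blocks have sizes [2 ^ i] for [i < r], and the middle block has the remaining
   [M - 2 * (2 ^ r - 1)] points. This [r] keeps the remainder roughly between [2 ^ r / 4] and
   [5 * 2 ^ r / 2], hence comparable with its neighbours of size [2 ^ (r - 1)]. *)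
set M := N.+1; pose r := trunc_log 2 ((4 * M + 10) %/ 9).
have posM : (0 < (4 * M + 10) %/ 9)%N by rewrite /M; nlia.
have r1 : (9 * 2 ^ r <= 4 * M + 10)%N.
  have := trunc_logP (isT : (1 < 2)%N) posM; rewrite -/r; nlia.
have r2 : (4 * M + 10 < 18 * 2 ^ r)%N.
  have := trunc_log_ltn ((4 * M + 10) %/ 9) (isT : (1 < 2)%N).
  rewrite -/r expnS; nlia.
have rk : (2 * r + 1 <= 2 * trunc_log 2 M + 3)%N.
  suff : (r <= (trunc_log 2 M).+1)%N by nlia.
  rewrite -trunc_log2_double; last by [].
  by apply: leq_trunc_log; rewrite /M -muln2; nlia.
have pw i : (0 < 2 ^ i)%N by rewrite expn_gt0.
have pwle i j : (i <= j)%N -> (2 ^ i <= 2 ^ j)%N by move=> ij; rewrite leq_pexp2l.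
(* The right half mirrors the left one. Past [2 * r] the truncated exponent is 0, so [b] stays at
   [M]. *)
pose b i := if (i <= r)%N then (2 ^ i - 1)%N else (M - (2 ^ (2 * r + 1 - i) - 1))%N.
have szL i : (i < r)%N -> (b i.+1 - b i = 2 ^ i)%N.
  by move=> ir; rewrite /b ir (ltnW ir) expnS; have := pw i; nlia.
have szM : (b r.+1 - b r = M - (2 ^ r - 1) - (2 ^ r - 1))%N.
  rewrite /b leqnn ltnn; have -> : (2 * r + 1 - r.+1 = r)%N by nlia.
  by have := pw r; nlia.
have szR i j : (r < i)%N -> (i + j = 2 * r)%N -> (b i.+1 - b i = 2 ^ j)%N.
  move=> ri ij; rewrite /b.
  have -> : (i <= r)%N = false by nlia.
  have -> : (i.+1 <= r)%N = false by nlia.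
  have -> : (2 * r + 1 - i = j.+1)%N by nlia.
  have -> : (2 * r + 1 - i.+1 = j)%N by nlia.
  by have := pw j; have := pwle j.+1 r; rewrite expnS; have := pw r; nlia.
have sbig i : (2 * r < i)%N -> b i = M.
  move=> ri; rewrite /b; have -> : (i <= r)%N = false by nlia.
  by have -> : (2 * r + 1 - i = 0)%N; nlia.
have mb i : (b i <= b i.+1)%N.
  case: (ltngtP i r) => [ir|ir|->].
  - by have := szL i ir; have := pw i; nlia.
  - case: (leqP i (2 * r)) => i2; last by rewrite !sbig ?subnn//; nlia.
    by have := szR i (2 * r - i)%N ir (subnKC i2); have := pw (2 * r - i)%N; nlia.
  - rewrite /b leqnn ltnn; have -> : (2 * r + 1 - r.+1 = r)%N by nlia.
    by have := pw r; nlia.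
exists (fun i => a + b i)%N; split.
- by rewrite /b /= expn0 addn0.
- by move=> i ki; rewrite sbig//; nlia.
- by move=> i; rewrite leq_add2l.
move=> i _; rewrite !subnDl.
case: (ltngtP i r) => [ir|ir|iE].
- rewrite (szL i ir); case: i ir => [|i] ir; first by rewrite expn0.
  rewrite (szL i); last by nlia.
  move=> _; split=> //; first by rewrite expnS; nlia.
  case: (ltngtP i.+2 r) => [ir'|ir'|ir']; [|by nlia|].
    by rewrite szL// !expnS; nlia.
  rewrite ir' szM; have rE : (2 ^ r = 2 * (2 * 2 ^ i))%N by rewrite -ir' !expnS.
  by rewrite expnS; have := pw i; nlia.
- case: (leqP i (2 * r)) => i2; last by rewrite (sbig i i2) (sbig i.+1) ?subnn//; nlia.
  have ij := subnKC i2; rewrite (szR i _ ir ij); move: (2 * r - i)%N ij => j ij.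
  case: j ij => [|j] ij; first by rewrite expn0.
  move=> _; split; first by nlia.
    case: (ltngtP r.+1 i) => [ri|ri|ri]; [|by nlia|].
      rewrite -{1}(prednK (leq_trans (ltn0Sn r) ir)) (szR i.-1 j.+2); [|by nlia..].
      by rewrite !expnS; nlia.
    rewrite -ri /= szM; have rE : (2 ^ r = 2 * 2 ^ j.+1)%N.
      by rewrite -expnS; congr (2 ^ _)%N; nlia.
    by move: rE; rewrite expnS; have := pw j; nlia.
  by rewrite (szR i.+1 j); rewrite ?expnS; nlia.
rewrite iE szM => szi.
case rE : r => [|r']; first by move: r2; rewrite rE expn0; nlia.
have r2E : (2 ^ r = 2 * 2 ^ r')%N by rewrite rE expnS.
rewrite -rE; split; first by nlia.
  have -> : (b r - b r.-1 = 2 ^ r')%N by rewrite rE /= szL// rE.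
  by have := pw r'; nlia.
by rewrite (szR r.+1 r'); have := pw r'; nlia.
Qed.

End Blocks.

(** * Pairings summed over Whitney blocks and over their pieces *)

Section Pairing.
Context {R : realType}.
Implicit Types (f g e : nat -> R) (p q h i j l : nat).

Definition energy e p q : R := tails e p q ^+ 2 / (q - p)%:R ^+ 3.

Lemma energy_ge0 e p q : 0 <= energy e p q.
Proof. by rewrite divr_ge0 ?sqr_ge0// exprn_ge0. Qed.

Lemma whitney_le a b k c i j : whitney a b k c -> (i <= j)%N -> (c i <= c j)%N.
Proof.
case=> _ _ mc _ /subnKC <-; elim: (j - i)%N => [|h IH]; first by rewrite addn0.
by rewrite addnS; exact: leq_trans IH (mc _).
Qed.

Lemma whitney_bounds a b k c i : whitney a b k c -> (a <= c i <= b)%N.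
Proof.
move=> W; have [c0 cb _ _] := W; apply/andP; split.
  by rewrite -c0; exact: (whitney_le W).
by rewrite -(cb (maxn i k)) ?leq_maxr//; exact: (whitney_le W (leq_maxl _ _)).
Qed.

(** A block occurs in at most three enlarged blocks: as the centre, as the left and as the right
    neighbour. *)
Lemma whitney_sum_nrm2 f a b k c : whitney a b k c ->
  \sum_(0 <= i < k) nrm2 f (c i.-1) (c i.+2) <= 3 * nrm2 f a b.
Proof.
move=> W; have [c0 cb mc _] := W.
have mono i j : (i <= j)%N -> (c i <= c j)%N := whitney_le W.
have sub i j : (a <= i)%N -> (j <= b)%N -> nrm2 f i j <= nrm2 f a b.
  exact: nrm2_sub.
have leb i : (c i <= b)%N by have /andP[] := whitney_bounds i W.
have lea i : (a <= c i)%N by have /andP[] := whitney_bounds i W.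
have s1 : \sum_(0 <= i < k) nrm2 f (c i.-1) (c i) <= nrm2 f a b.
  rewrite /nrm2 (sum_cuts (c := fun i => c i.-1)); last first.
    by move=> i; apply: mono; rewrite /=; nlia.
  exact: sub.
have s2 : \sum_(0 <= i < k) nrm2 f (c i) (c i.+1) <= nrm2 f a b.
  by rewrite /nrm2 (sum_cuts k _ mc); exact: sub.
have s3 : \sum_(0 <= i < k) nrm2 f (c i.+1) (c i.+2) <= nrm2 f a b.
  by rewrite /nrm2 (sum_cuts (c := fun i => c i.+1))//; exact: sub.
have -> : \sum_(0 <= i < k) nrm2 f (c i.-1) (c i.+2) =
    \sum_(0 <= i < k) nrm2 f (c i.-1) (c i) +
    (\sum_(0 <= i < k) nrm2 f (c i) (c i.+1) +
     \sum_(0 <= i < k) nrm2 f (c i.+1) (c i.+2)).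
  rewrite -!big_split; apply: eq_bigr => i _ /=.
  rewrite -(nrm2_cat f (mc i) (mc i.+1)).
  by rewrite -nrm2_cat ?mono ?leq_pred//; exact: leq_trans (leqnSn _) _.
lra.
Qed.

Variables (gap : nat -> R) (K : R).
Hypothesis gapK : forall i, 1 <= gap i <= K.

Let K1 : 1 <= K.
Proof. by have /andP[/le_trans] := gapK 0; exact. Qed.
Let K0 : 0 < K. Proof. exact: lt_le_trans ltr01 K1. Qed.
Let gap0 i : 0 < gap i.
Proof. by have /andP[/(lt_le_trans ltr01)] := gapK i. Qed.

(** On a block, [almost_affine_pairing] is applied with slope 0 and the error [D] that the buffers
    provide. Half of [eps] pays for the block itself, and a sixth for the enlarged block, since
    these overlap three times. *)
Lemma convex_pairing g e a b k c (eps : R) : 0 < eps -> whitney a b k c ->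
  slopes_nondecreasing gap g a b ->
  `|\sum_(a <= i < b) g i * e i| <= eps * nrm2 g a b +
    2 ^+ 18 * K ^+ 2 / eps * \sum_(0 <= i < k) energy e (c i) (c i.+1).
Proof.
move=> eps0 W cg; have [c0 cb mc wc] := W.
pose B : R := 2 ^+ 13.
have B0 : 0 < B by rewrite exprn_gt0.
have B32 : 32 <= B.
  rewrite /B (_ : 32 = 2 ^+ 5); last by ring.
  by rewrite ler_weXn2l// ler1n.
have B18 : 2 ^+ 18 = 32 * B by rewrite /B; ring.
have block i : (i < k)%N ->
    `|\sum_(c i <= l < c i.+1) g l * e l| <=
    eps / 2 * nrm2 g (c i) (c i.+1) + eps / 6 * nrm2 g (c i.-1) (c i.+2) +
    2 ^+ 18 * K ^+ 2 / eps * energy e (c i) (c i.+1).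
  move=> ik; set T := nrm2 g (c i.-1) (c i.+2); set y := energy _ _ _.
  have T0 : 0 <= T := nrm2_ge0 _ _ _.
  have y0 : 0 <= y := energy_ge0 _ _ _.
  have q0 : 0 <= 2 ^+ 18 * K ^+ 2 / eps.
    by apply: divr_ge0 (ltW eps0); rewrite mulr_ge0// ?exprn_ge0// ltW.
  have [ci|ci] := leqP (c i.+1) (c i).
    rewrite big_geq// normr0; apply: addr_ge0; last exact: mulr_ge0.
    by apply: addr_ge0; apply: mulr_ge0; rewrite ?nrm2_ge0//; lra.
  set N := (c i.+1 - c i)%N.
  have N0 : 0 < N%:R :> R by rewrite ltr0n subn_gt0.
  have N30 : 0 < N%:R ^+ 3 :> R by rewrite exprn_gt0.
  (* A block of one point contains no slope, and [whitney] guarantees it no buffers. *)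
  pose D := if (N <= 1)%N then 0 else Num.sqrt (B * T / N%:R ^+ 3).
  have D0 : 0 <= D by rewrite /D; case: ifP => // _; exact: sqrtr_ge0.
  have DT : N%:R ^+ 3 * D ^+ 2 <= B * T.
    rewrite /D; case: ifP => _.
      by rewrite expr0n mulr0 mulr_ge0// ltW.
    rewrite sqr_sqrtr; first by rewrite mulrC divfK// gt_eqF.
    by rewrite divr_ge0 ?mulr_ge0 ?(ltW B0) ?(ltW N30).
  have sD l : (c i <= l)%N -> (l.+1 < c i.+1)%N ->
      `|g l.+1 - g l - gap l * 0| <= gap l * D.
    move=> il li; rewrite mulr0 subr0 (slopeE gapK) normrM (gtr0_norm (gap0 l)).
    rewrite ler_wpM2l ?(ltW (gap0 l))// /D ifF; last first.
      by apply/negbTE; rewrite -ltnNge /N; nlia.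
    have [ipos s1 s2] : [/\ (0 < i)%N, (c i.+1 - c i <= 8 * (c i - c i.-1))%N &
       (c i.+1 - c i <= 8 * (c i.+2 - c i.+1))%N] by apply: wc => //; nlia.
    rewrite -(@ler_sqr R) ?nnegrE ?sqrtr_ge0// sqr_sqrtr; last first.
      by rewrite divr_ge0 ?mulr_ge0 ?(ltW B0) ?(ltW N30).
    rewrite real_normK ?num_real// ler_pdivlMr// mulrC.
    apply: (slope_sqr_le gapK) => //; try nlia.
    apply: slopes_nondecreasingS cg.
      by have /andP[] := whitney_bounds i.-1 W.
    by have /andP[] := whitney_bounds i.+2 W.
  have e20 : 0 < eps / 2 by lra.
  have := almost_affine_pairing gapK e ci D0 e20 sD.
  rewrite -/N -/(energy e (c i) (c i.+1)) -/y => H; apply: le_trans H _.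
  set t := tails _ _ _.
  have tN : t ^+ 2 = y * N%:R ^+ 3 by rewrite /y /energy divfK// gt_eqF.
  have := @mul_le_sqrD R D (4 * K * t) (eps / (6 * B) * N%:R ^+ 3).
  have -> : (4 * K * t) ^+ 2 / (4 * (eps / (6 * B) * N%:R ^+ 3)) =
      24 * B * K ^+ 2 / eps * y.
    rewrite !exprMn tN; field; rewrite !gt_eqF//.
  have -> : eps / (6 * B) * N%:R ^+ 3 * D ^+ 2 =
      eps / (6 * B) * (N%:R ^+ 3 * D ^+ 2) by ring.
  have eB : 0 < eps / (6 * B) by rewrite divr_gt0// mulr_gt0.
  move=> /(_ (mulr_gt0 eB N30)) H.
  have H2 : eps / (6 * B) * (N%:R ^+ 3 * D ^+ 2) <= eps / 6 * T.
    rewrite (_ : eps / 6 * T = eps / (6 * B) * (B * T)).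
      by rewrite ler_wpM2l// ltW.
    by field; rewrite gt_eqF.
  have H3 : 109 * K ^+ 2 / (eps / 2) * y + 24 * B * K ^+ 2 / eps * y <=
      2 ^+ 18 * K ^+ 2 / eps * y.
    rewrite B18 -mulrDl ler_wpM2r//.
    have -> : 109 * K ^+ 2 / (eps / 2) + 24 * B * K ^+ 2 / eps =
       (218 + 24 * B) * (K ^+ 2 / eps) by field; rewrite gt_eqF.
    rewrite -mulrA ler_wpM2r ?divr_ge0 ?sqr_ge0 ?(ltW eps0)//; lra.
  rewrite (_ : 4 * K * D * t = D * (4 * K * t)); last by ring.
  lra.
rewrite -{1}c0 -{1}(cb k (leqnn k)) -(sum_cuts k (fun l => g l * e l) mc).
apply: le_trans (ler_norm_sum _ _ _) _.
apply: le_trans (ler_sum_nat (fun i ik => block i (andP ik).2)) _.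
rewrite !big_split /= -!mulr_sumr lerD2r.
have S1 : \sum_(0 <= i < k) nrm2 g (c i) (c i.+1) = nrm2 g a b.
  by rewrite /nrm2 (sum_cuts k _ mc) c0 cb.
have S3 : eps / 6 * \sum_(0 <= i < k) nrm2 g (c i.-1) (c i.+2) <=
    eps / 6 * (3 * nrm2 g a b).
  by apply: ler_wpM2l; [lra | exact: whitney_sum_nrm2].
rewrite S1; lra.
Qed.

(** For [p < q] this is the ceiling of [(q - p) / m]; the cap in [piece] can leave the last pieces
    shorter or empty. *)
Definition piece_len p q m : nat := ((q - p).-1 %/ m).+1.

Definition piece p q m j : nat := minn (p + j * piece_len p q m) q.

Lemma piece_le p q m j : (p <= q)%N -> (piece p q m j <= piece p q m j.+1)%N.
Proof. by move=> pq; rewrite /piece mulSn; nlia. Qed.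

Lemma piece0 p q m : (p <= q)%N -> piece p q m 0 = p.
Proof. by move=> pq; rewrite /piece; nlia. Qed.

Lemma pieceE p q m : (0 < m)%N -> (p <= q)%N -> piece p q m m = q.
Proof.
move=> m0 pq; rewrite /piece /piece_len.
have := divn_eq (q - p).-1 m; have := ltn_pmod (q - p).-1 m0.
rewrite mulnS [(m * _)%N]mulnC; nlia.
Qed.

Lemma piece_size p q m j : (piece p q m j.+1 - piece p q m j <= piece_len p q m)%N.
Proof. by rewrite /piece mulSn; nlia. Qed.

(* The slopes being monotone, their oscillations over the pieces add up to at
   most their oscillation over the block. *)
Lemma block_pairing f g e p q m (D y eps : R) :
  (p < q)%N -> (0 < m)%N -> 0 < eps -> 0 <= D -> 0 <= y ->
  slopes_nondecreasing gap f p q -> slopes_nondecreasing gap g p q ->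
  (forall l, (p <= l)%N -> (l.+1 < q)%N ->
     `|slope gap f l| <= D /\ `|slope gap g l| <= D) ->
  (forall j, (j < m)%N -> tails e (piece p q m j) (piece p q m j.+1) ^+ 2 <=
     y * (piece p q m j.+1 - piece p q m j)%:R ^+ 3) ->
  `|\sum_(p <= l < q) (f l - g l) * e l| <= eps * nrm2 (fun l => f l - g l) p q +
    109 * K ^+ 2 / eps *
      \sum_(0 <= j < m) energy e (piece p q m j) (piece p q m j.+1) +
    (if piece_len p q m == 1%N then 0 else
       16 * K * D * Num.sqrt (y * (piece_len p q m)%:R ^+ 3)).
Proof.
move=> pq m0 eps0 D0 y0 cf cg slD ty.
set w := piece_len p q m; set c := piece p q m.
have mc j : (c j <= c j.+1)%N by apply: piece_le; exact: ltnW.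
have c0 : c 0%N = p by apply: piece0; exact: ltnW.
have cm : c m = q by apply: pieceE => //; exact: ltnW.
(* The slope at [l] involves [l.+1], so the last one inside the block is at [q - 2]; [cl] clamps
   indices accordingly. The oscillation over a piece starts at the point before the piece, so that
   oscillations of consecutive pieces telescope. *)
pose cl l := maxn p (minn l (q - 2)).
pose osc (u : nat -> R) j := slope gap u (cl (c j.+1).-1) - slope gap u (cl (c j).-1).
(* Pieces of one point contain no slope. This case is kept apart because the bound of the piece
   length by [2 * (q - p) / m], used later, may fail for it. *)
pose delta j := if w == 1%N then 0 else osc f j + osc g j.
have pc j : (p <= c j)%N.
  by rewrite /c /piece; nlia.
have cq j : (c j <= q)%N by rewrite /c /piece; nlia.
have clP l l' : (l <= l')%N -> (2 <= q - p)%N ->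
    [/\ (p <= cl l)%N, (cl l <= cl l')%N & ((cl l').+1 < q)%N].
  by rewrite /cl => ll' q2; split; nlia.
have w2 : w != 1%N -> (2 <= q - p)%N.
  rewrite /w /piece_len; case E : (q - p)%N => [|[|n]] //; by rewrite div0n.
have osc_ge0 (u : nat -> R) j : w != 1%N ->
    slopes_nondecreasing gap u p q -> 0 <= osc u j.
  move=> w1 ch; rewrite subr_ge0.
  have [] := @clP (c j).-1 (c j.+1).-1 _ (w2 w1); last by move=> *; exact: ch.
  by have := mc j; nlia.
have delta_ge0 j : 0 <= delta j.
  by rewrite /delta; case: ifPn => // w1; rewrite addr_ge0 ?osc_ge0.
have sum_delta : \sum_(0 <= j < m) delta j <= 4 * D.
  have [w1|w1] := eqVneq w 1%N.
    by rewrite big1 ?mulr_ge0// => j _; rewrite /delta w1.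
  rewrite (eq_bigr (fun j => osc f j + osc g j)); last first.
    by move=> j _; rewrite /delta (negbTE w1).
  have oscD (u : nat -> R) :
      (forall l, (p <= l)%N -> (l.+1 < q)%N -> `|slope gap u l| <= D) ->
      \sum_(0 <= j < m) osc u j <= 2 * D.
    move=> hD; rewrite (telescope_sumr (fun j => slope gap u (cl (c j).-1)))//.
    have [] := @clP (c 0%N).-1 (c m).-1 _ (w2 w1); first by rewrite c0 cm; nlia.
    move=> h1 h2 h3.
    have := hD (cl (c m).-1) (leq_trans h1 h2) h3.
    have := hD (cl (c 0%N).-1) h1 (leq_ltn_trans (h2 : _.+1 <= _.+1)%N h3).
    by rewrite !ler_norml => /andP[? ?] /andP[? ?]; lra.
  rewrite big_split /=.
  have := oscD f (fun l a b => (slD l a b).1).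
  have := oscD g (fun l a b => (slD l a b).2); lra.
set S := Num.sqrt (y * w%:R ^+ 3); have S0 : 0 <= S := sqrtr_ge0 _.
have one j : (j < m)%N ->
    `|\sum_(c j <= l < c j.+1) (f l - g l) * e l| <=
    eps * nrm2 (fun l => f l - g l) (c j) (c j.+1) +
    109 * K ^+ 2 / eps * energy e (c j) (c j.+1) + 4 * K * S * delta j.
  move=> jm; have [cc|cc] := leqP (c j.+1) (c j).
    rewrite big_geq// normr0; apply: addr_ge0; last by rewrite !mulr_ge0 ?(ltW K0).
    apply: addr_ge0; first by rewrite mulr_ge0 ?nrm2_ge0 ?(ltW eps0).
    apply: mulr_ge0; last exact: energy_ge0.
    by apply: divr_ge0 (ltW eps0); apply: mulr_ge0 => //; exact: sqr_ge0.
  have sz : (c j.+1 - c j <= w)%N := piece_size _ _ _ _.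
  pose a0 := slope gap f (c j) - slope gap g (c j).
  have Hd l : (c j <= l)%N -> (l.+1 < c j.+1)%N ->
      `|(f l.+1 - g l.+1) - (f l - g l) - gap l * a0| <= gap l * delta j.
    move=> jl lj.
    have -> : (f l.+1 - g l.+1) - (f l - g l) - gap l * a0 =
        gap l * ((slope gap f l - slope gap f (c j)) -
                 (slope gap g l - slope gap g (c j))).
      have := slopeE gapK f l; have := slopeE gapK g l; rewrite /a0; lra.
    rewrite normrM (gtr0_norm (gap0 l)) ler_wpM2l ?(ltW (gap0 l))//.
    rewrite /delta ifF; last by apply/negbTE; move: sz jl lj; nlia.
    have q2 : (2 <= q - p)%N by move: (pc j) (cq j.+1) jl lj; nlia.
    have osc_le (u : nat -> R) : slopes_nondecreasing gap u p q ->
        0 <= slope gap u l - slope gap u (c j) <= osc u j.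
      move=> ch; rewrite subr_ge0; apply/andP; split.
        by apply: ch => //; move: (pc j) (cq j.+1); nlia.
      rewrite /osc lerB//.
        by apply: ch; rewrite /cl; move: (pc j) (cq j.+1); nlia.
      by apply: ch; rewrite /cl; move: (pc j) (cq j.+1); nlia.
    have /andP[f1 f2] := osc_le f cf; have /andP[g1 g2] := osc_le g cg.
    by rewrite ler_norml; apply/andP; split; lra.
  have := almost_affine_pairing (g := fun l => f l - g l) gapK e cc (delta_ge0 j) eps0 Hd.
  rewrite -/(energy e (c j) (c j.+1)) => H; apply: le_trans H _.
  rewrite lerD2l -[leLHS]mulrA -[leRHS]mulrA; apply: ler_wpM2l.
    by rewrite mulr_ge0 ?(ltW K0).
  rewrite mulrC; apply: ler_wpM2r => //; rewrite -(@ler_sqr R) ?nnegrE ?tails_ge0//.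
  rewrite sqr_sqrtr ?mulr_ge0 ?exprn_ge0//.
  apply: le_trans (ty j jm) _; rewrite ler_wpM2l// lerXn2r ?nnegrE//.
  by rewrite ler_nat.
rewrite -{1}c0 -{1}cm -(sum_cuts m (fun l => (f l - g l) * e l) mc).
apply: le_trans (ler_norm_sum _ _ _) _.
apply: le_trans (ler_sum_nat (fun j jm => one j (andP jm).2)) _.
rewrite !big_split /= -!mulr_sumr.
have -> : \sum_(0 <= j < m) nrm2 (fun l => f l - g l) (c j) (c j.+1) =
    nrm2 (fun l => f l - g l) p q.
  by rewrite /nrm2 (sum_cuts m _ mc) c0 cm.
rewrite lerD2l; case: ifPn => w1.
  by rewrite big1 ?mulr0// => j _; rewrite /delta w1.
rewrite (_ : 16 * K * D * S = 4 * K * S * (4 * D)); last by ring.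
by rewrite ler_wpM2l// !mulr_ge0// ltW.
Qed.

(** Two arithmetic-geometric mean inequalities under one square: the root of a sum of two products
    is bounded by a linear expression, with a weight chosen freely for each product. *)
Lemma mulD4_le_sqr (r s t v : R) : 0 <= r -> 0 <= s -> 0 <= t -> 0 <= v ->
  4 * r * s + 4 * t * v <= (r + s + (t + v)) ^+ 2.
Proof.
move=> r0 s0 t0 v0.
have := sqr_ge0 (r - s); have := sqr_ge0 (t - v).
have : 0 <= (r + s) * (t + v) by rewrite mulr_ge0 ?addr_ge0.
by rewrite !expr2; lra.
Qed.

(** The buffers bound the slopes of [f] and [g] on a block by the norms of [g] and [f - g], as
    [f = g + (f - g)]. With piece lengths of order [N / m], the remainder is of order
    [sqrt ((Tg + Th) * y / m ^ 3)], where [Tg] and [Th] are the squared norms of [g] and [f - g] on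
    the enlarged block. The share of [Th] is absorbed into [eps]; that of [Tg] is split with a
    weight [lam] to be optimized later. *)
Lemma pairing_refined f g e a b k c m (y eps lam : R) :
  (0 < m)%N -> 0 < eps -> 0 < lam -> 0 <= y -> whitney a b k c ->
  slopes_nondecreasing gap f a b -> slopes_nondecreasing gap g a b ->
  (forall i j, (i < k)%N -> (j < m)%N ->
    tails e (piece (c i) (c i.+1) m j) (piece (c i) (c i.+1) m j.+1) ^+ 2 <=
     y * (piece (c i) (c i.+1) m j.+1 - piece (c i) (c i.+1) m j)%:R ^+ 3) ->
  `|\sum_(a <= l < b) (f l - g l) * e l| <= eps * nrm2 (fun l => f l - g l) a b +
    2 ^+ 8 * K ^+ 2 / eps * \sum_(0 <= i < k) \sum_(0 <= j < m)
      energy e (piece (c i) (c i.+1) m j) (piece (c i) (c i.+1) m j.+1) +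
    2 ^+ 6 * K * lam / m%:R ^+ 3 * nrm2 g a b +
    k%:R * (2 ^+ 19 * K * y / lam + 2 ^+ 26 * K ^+ 2 * y / (eps * m%:R ^+ 3)).
Proof.
move=> m0 eps0 lam0 y0 W cf cg ty; have [c0 cb mc wc] := W.
pose h l := f l - g l.
have mR0 : 0 < m%:R :> R by rewrite ltr0n.
have m30 : 0 < m%:R ^+ 3 :> R by rewrite exprn_gt0.
pose B : R := 2 ^+ 13.
have B0 : 0 < B by rewrite exprn_gt0.
pose Q i := \sum_(0 <= j < m)
  energy e (piece (c i) (c i.+1) m j) (piece (c i) (c i.+1) m j.+1).
have Q0 i : 0 <= Q i by apply: sumr_ge0 => j _; exact: energy_ge0.
pose G : R := 2 ^+ 19 * K * y / lam + 2 ^+ 26 * K ^+ 2 * y / (eps * m%:R ^+ 3).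
have G10 : 0 <= 2 ^+ 19 * K * y / lam.
  by rewrite divr_ge0 ?(ltW lam0)// !mulr_ge0 ?exprn_ge0 ?(ltW K0).
have G20 : 0 <= 2 ^+ 26 * K ^+ 2 * y / (eps * m%:R ^+ 3).
  by rewrite divr_ge0 ?mulr_ge0 ?exprn_ge0 ?(ltW K0) ?(ltW eps0).
have q0 : 0 <= 2 ^+ 8 * K ^+ 2 / eps.
  by rewrite divr_ge0 ?mulr_ge0 ?exprn_ge0 ?(ltW K0) ?(ltW eps0).
have l0 : 0 <= 2 ^+ 4 * K * lam / m%:R ^+ 3.
  by rewrite divr_ge0 ?(ltW m30)// !mulr_ge0 ?exprn_ge0 ?(ltW K0) ?(ltW lam0).
have block i : (i < k)%N ->
    `|\sum_(c i <= l < c i.+1) (f l - g l) * e l| <=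
    eps / 2 * nrm2 h (c i) (c i.+1) + eps / 6 * nrm2 h (c i.-1) (c i.+2) +
    2 ^+ 8 * K ^+ 2 / eps * Q i +
    2 ^+ 4 * K * lam / m%:R ^+ 3 * nrm2 g (c i.-1) (c i.+2) + G.
  move=> ik; set Th := nrm2 h (c i.-1) _; set Tg := nrm2 g _ _.
  have Th0 : 0 <= Th := nrm2_ge0 _ _ _.
  have Tg0 : 0 <= Tg := nrm2_ge0 _ _ _.
  have Tf : nrm2 f (c i.-1) (c i.+2) <= 2 * Tg + 2 * Th.
    apply: le_trans (nrm2_addl g h _ _); rewrite /nrm2 le_eqVlt; apply/orP; left.
    by apply/eqP; apply: eq_bigr => l _; rewrite /h subrKC.
  have [ci|ci] := leqP (c i.+1) (c i).
    rewrite big_geq// normr0 /G; apply: addr_ge0; last exact: addr_ge0.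
    apply: addr_ge0; last exact: mulr_ge0.
    apply: addr_ge0; last exact: mulr_ge0.
    by apply: addr_ge0; apply: mulr_ge0; rewrite ?nrm2_ge0//; lra.
  set N := (c i.+1 - c i)%N.
  have N30 : 0 < N%:R ^+ 3 :> R by rewrite exprn_gt0// ltr0n subn_gt0.
  pose V := B * (2 * Tg + 2 * Th).
  have V0 : 0 <= V by rewrite /V mulr_ge0 ?(ltW B0)//; lra.
  pose D := Num.sqrt (V / N%:R ^+ 3).
  have D0 : 0 <= D by exact: sqrtr_ge0.
  have DE : D ^+ 2 * N%:R ^+ 3 = V.
    by rewrite sqr_sqrtr ?divr_ge0 ?(ltW N30)// divfK// gt_eqF.
  have lea := whitney_bounds i.-1 W; have leb := whitney_bounds i.+2 W.
  have slD (u : nat -> R) l : nrm2 u (c i.-1) (c i.+2) <= 2 * Tg + 2 * Th ->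
      slopes_nondecreasing gap u a b ->
      (c i <= l)%N -> (l.+1 < c i.+1)%N -> `|slope gap u l| <= D.
    move=> uT cu il li.
    have [ipos s1 s2] : [/\ (0 < i)%N, (c i.+1 - c i <= 8 * (c i - c i.-1))%N &
       (c i.+1 - c i <= 8 * (c i.+2 - c i.+1))%N] by apply: wc => //; nlia.
    rewrite -(@ler_sqr R) ?nnegrE// real_normK ?num_real//.
    rewrite -(ler_pM2r N30) DE mulrC.
    apply: le_trans (_ : B * nrm2 u (c i.-1) (c i.+2) <= _); last first.
      by rewrite /V ler_wpM2l// ltW.
    apply: (slope_sqr_le gapK) => //; try nlia.
    apply: slopes_nondecreasingS cu.
      by have /andP[] := lea.
    by have /andP[] := leb.
  have slfg l : (c i <= l)%N -> (l.+1 < c i.+1)%N ->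
      `|slope gap f l| <= D /\ `|slope gap g l| <= D.
    move=> il li; split; first exact: slD.
    by apply: slD => //; rewrite -/Tg; lra.
  have cfi : slopes_nondecreasing gap f (c i) (c i.+1).
    apply: slopes_nondecreasingS cf.
      by have /andP[] := whitney_bounds i W.
    by have /andP[] := whitney_bounds i.+1 W.
  have cgi : slopes_nondecreasing gap g (c i) (c i.+1).
    apply: slopes_nondecreasingS cg.
      by have /andP[] := whitney_bounds i W.
    by have /andP[] := whitney_bounds i.+1 W.
  have e20 : 0 < eps / 2 by lra.
  have := block_pairing ci m0 e20 D0 y0 cfi cgi slfg (ty i ^~ ik).
  rewrite -/(Q i) -/h; set X := (if _ then _ else _) => H.
  apply: le_trans H _.
  have HQ : 109 * K ^+ 2 / (eps / 2) * Q i <= 2 ^+ 8 * K ^+ 2 / eps * Q i.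
    apply: ler_wpM2r => //.
    have -> : 109 * K ^+ 2 / (eps / 2) = 218 * (K ^+ 2 / eps).
      by field; rewrite gt_eqF.
    rewrite -mulrA; apply: ler_wpM2r; last by lra.
    by rewrite divr_ge0 ?sqr_ge0 ?(ltW eps0).
  suff HX : X <= eps / 6 * Th + 2 ^+ 4 * K * lam / m%:R ^+ 3 * Tg + G by lra.
  rewrite /X; case: ifPn => w1.
    rewrite /G; apply: addr_ge0; last exact: addr_ge0.
    by apply: addr_ge0; last exact: mulr_ge0; apply: mulr_ge0 => //; lra.
  set w := piece_len _ _ _ in w1 *.
  (* Since [w] is at least 2 here, [w] is at most twice [w - 1 = (N - 1) %/ m]. *)
  have mw : (m * w <= 2 * N)%N.
    move: w1; rewrite /w /piece_len -/N.
    have := leq_divM N.-1 m; case: (N.-1 %/ m)%N => // n.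
    by rewrite mulnSr [(m * n.+1)%N]mulnC mulSn; nlia.
  have mw3 : m%:R ^+ 3 * w%:R ^+ 3 <= 8 * N%:R ^+ 3 :> R.
    rewrite -exprMn (_ : 8 * _ = (2 * N%:R) ^+ 3); last by ring.
    by rewrite -!natrM lerXn2r ?nnegrE// ler_nat.
  set x := D * Num.sqrt (y * w%:R ^+ 3).
  have x0 : 0 <= x by rewrite mulr_ge0 ?sqrtr_ge0.
  pose z := 16 * B * y / m%:R ^+ 3.
  have z0 : 0 <= z by rewrite divr_ge0 ?(ltW m30)// !mulr_ge0 ?(ltW B0).
  have x2 : x ^+ 2 <= (Tg + Th) * z.
    have -> : x ^+ 2 = D ^+ 2 * (y * w%:R ^+ 3).
      rewrite /x exprMn [X in _ * X]sqr_sqrtr//.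
      by apply: mulr_ge0 => //; exact: exprn_ge0.
    rewrite (_ : (Tg + Th) * z = (Tg + Th) * (16 * B * y) / m%:R ^+ 3); last first.
      by rewrite /z; ring.
    rewrite ler_pdivlMr//.
    rewrite (_ : (Tg + Th) * _ = y * (8 * V)); last by rewrite /V; ring.
    rewrite -DE (_ : _ * _ * _ = y * (D ^+ 2 * (m%:R ^+ 3 * w%:R ^+ 3))); last by ring.
    rewrite ler_wpM2l// [leRHS]mulrCA ler_wpM2l// sqr_ge0//.
  (* [mu] is fixed by the share [eps / 6] of an enlarged block, while [la] keeps [lam] free. *)
  pose la := lam / m%:R ^+ 3; pose mu := eps / (96 * K).
  have la0 : 0 < la by rewrite divr_gt0.
  have mu0 : 0 < mu by rewrite divr_gt0// mulr_gt0.
  have xle : x <= la * Tg + z / (4 * la) + (mu * Th + z / (4 * mu)).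
    have A0 : 0 <= la * Tg by rewrite mulr_ge0// ltW.
    have C0 : 0 <= mu * Th by rewrite mulr_ge0// ltW.
    have A1 : 0 <= z / (4 * la) by rewrite divr_ge0// mulr_ge0// ltW.
    have C1 : 0 <= z / (4 * mu) by rewrite divr_ge0// mulr_ge0// ltW.
    rewrite -(@ler_sqr R) ?nnegrE ?addr_ge0//; apply: le_trans x2 _.
    have AA : Tg * z = 4 * (la * Tg) * (z / (4 * la)) by field; rewrite gt_eqF.
    have CC : Th * z = 4 * (mu * Th) * (z / (4 * mu)) by field; rewrite gt_eqF.
    rewrite mulrDl AA CC.
    exact: mulD4_le_sqr.
  have -> : 16 * K * D * Num.sqrt (y * w%:R ^+ 3) = 16 * K * x by rewrite /x; ring.
  have Kn : K != 0 by rewrite gt_eqF.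
  have mn : m%:R != 0 :> R by rewrite gt_eqF.
  have ln : lam != 0 by rewrite gt_eqF.
  have en : eps != 0 by rewrite gt_eqF.
  apply: le_trans (ler_wpM2l _ xle) _; first by rewrite mulr_ge0 ?(ltW K0).
  have E1 : 16 * K * (la * Tg) = 2 ^+ 4 * K * lam / m%:R ^+ 3 * Tg.
    by rewrite /la; field.
  have E2 : 16 * K * (z / (4 * la)) = 2 ^+ 19 * K * y / lam.
    by rewrite /la /z /B; field; rewrite ?mn ?ln.
  have E3 : 16 * K * (mu * Th) = eps / 6 * Th.
    by rewrite /mu; field.
  have E4 : 16 * K * (z / (4 * mu)) <= 2 ^+ 26 * K ^+ 2 * y / (eps * m%:R ^+ 3).
    have -> : 2 ^+ 26 = B * B by rewrite /B; ring.
    have -> : 16 * K * (z / (4 * mu)) =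
        96 * 64 * (B * (K ^+ 2 * y / (eps * m%:R ^+ 3))).
      by rewrite /mu /z; field; rewrite ?mn ?en ?Kn.
    rewrite (_ : B * B * K ^+ 2 * y / _ = B * (B * (K ^+ 2 * y / (eps * m%:R ^+ 3))));
      last by ring.
    apply: ler_wpM2r; last by rewrite /B; lra.
    by rewrite mulr_ge0 ?(ltW B0)// divr_ge0 ?mulr_ge0 ?(ltW K0) ?(ltW eps0) ?(ltW m30).
  rewrite !mulrDr E1 E2 E3 /G.
  move: (16 * K * (z / (4 * mu))) E4 => v E4.
  lra.
rewrite -/G; clearbody G.
rewrite -{1}c0 -{1}(cb k (leqnn k)) -(sum_cuts k (fun l => (f l - g l) * e l) mc).
apply: le_trans (ler_norm_sum _ _ _) _.
apply: le_trans (ler_sum_nat (fun i ik => block i (andP ik).2)) _.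
rewrite !big_split /= -!mulr_sumr sumr_const_nat subn0 -[G *+ k]mulr_natl.
rewrite lerD2r.
have S1 : \sum_(0 <= i < k) nrm2 h (c i) (c i.+1) = nrm2 h a b.
  by rewrite /nrm2 (sum_cuts k _ mc) c0 cb.
have S3 : eps / 6 * \sum_(0 <= i < k) nrm2 h (c i.-1) (c i.+2) <=
    eps / 6 * (3 * nrm2 h a b).
  by apply: ler_wpM2l; [lra | exact: whitney_sum_nrm2].
have S4 : 2 ^+ 4 * K * lam / m%:R ^+ 3 * \sum_(0 <= i < k) nrm2 g (c i.-1) (c i.+2)
    <= 2 ^+ 6 * K * lam / m%:R ^+ 3 * nrm2 g a b.
  apply: le_trans (ler_wpM2l l0 (whitney_sum_nrm2 g W)) _.
  rewrite (_ : 2 ^+ 6 * K * lam / m%:R ^+ 3 * nrm2 g a b =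
    2 ^+ 4 * K * lam / m%:R ^+ 3 * (4 * nrm2 g a b)); last by ring.
  by apply: ler_wpM2l => //; have := nrm2_ge0 g a b; lra.
rewrite S1; rewrite -/h; lra.
Qed.
End Pairing.

(** * Moments of partial sums of the noise *)

Lemma big_nat_ord_range (V : nmodType) (n p q : nat) (F : nat -> V) :
  (q <= n)%N ->
  \sum_(p <= l < q) F l = \sum_(i < n | (p <= i < q)%N) F i.
Proof.
move=> qn; rewrite -(big_mkord (fun i => (p <= i < q)%N)).
rewrite (big_nat_widen _ _ _ _ _ qn) (big_nat_widenl p 0)//.
by apply: eq_bigl => i; rewrite andbC.
Qed.

Lemma sqr_le_expR (R : realType) (x : R) : x ^+ 2 <= 4 * (expR x + expR (- x)).
Proof.
have pos (y : R) : 0 <= y -> y ^+ 2 <= 4 * expR y.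
  move=> y0; have -> : expR y = expR (y / 2) ^+ 2.
    by rewrite -expRM_natl; congr expR; field.
  have := expR_ge1Dx (y / 2) => H; have : 0 <= expR (y / 2) - y / 2 by lra.
  nra.
have [x0|x0] := leP 0 x.
  by have := pos x x0; have := expR_ge0 (- x); lra.
have := pos (- x); have := expR_ge0 x; rewrite sqrrN.
by move=> H1 /(_ _) H2; have := H2 ltac:(lra); lra.
Qed.

(* Beyond [3/2 * lam] the square is absorbed by the exponential. *)
Lemma sqr_le_expR_tail (R : realType) (lam x : R) : 0 < lam ->
  x ^+ 2 <= 9 / 2 * lam ^+ 2 + 8 / lam ^+ 2 * expR (- (3 / 2 * lam ^+ 2)) *
    (expR (lam * x) + expR (- (lam * x))).
Proof.
move=> lam0.
have pos (y : R) : 0 <= y -> y ^+ 2 <= 9 / 2 * lam ^+ 2 +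
    8 / lam ^+ 2 * expR (- (3 / 2 * lam ^+ 2)) * expR (lam * y).
  move=> y0; rewrite -[X in _ + X]mulrA -expRD.
  set E := expR _.
  have E0 : 0 <= 8 / lam ^+ 2 * E by rewrite !mulr_ge0 ?expR_ge0 ?invr_ge0 ?sqr_ge0.
  have [yl|yl] := leP y (3 / 2 * lam).
    by apply: le_trans (_ : y ^+ 2 <= 9 / 4 * lam ^+ 2) _; nra.
  pose z := lam * (y - 3 / 2 * lam).
  have zE : E = expR z by rewrite /E /z; congr expR; ring.
  have z0 : 0 <= z by rewrite mulr_ge0 ?subr_ge0 ?(ltW lam0)// ltW.
  have zz : z ^+ 2 <= 4 * expR z.
    have -> : expR z = expR (z / 2) ^+ 2.
      by rewrite -expRM_natl; congr expR; field.
    have := expR_ge1Dx (z / 2) => H; have : 0 <= expR (z / 2) - z / 2 by lra.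
    nra.
  have -> : y = 3 / 2 * lam + z / lam.
    by rewrite /z; field; rewrite gt_eqF.
  rewrite zE (_ : 8 / lam ^+ 2 * expR z = 8 * (expR z / lam ^+ 2)); last by ring.
  have : (z / lam) ^+ 2 <= 4 * (expR z / lam ^+ 2).
    by rewrite expr_div_n mulrA ler_pM2r// invr_gt0 exprn_gt0.
  set a := z / lam; set b := expR z / _ => ab.
  have := sqr_ge0 (3 / 2 * lam - a); nra.
have K0 : 0 <= 8 / lam ^+ 2 * expR (- (3 / 2 * lam ^+ 2)).
  by rewrite !mulr_ge0 ?expR_ge0 ?invr_ge0 ?sqr_ge0.
rewrite mulrDr; have [x0|x0] := leP 0 x.
  apply: le_trans (pos x x0) _.
  by rewrite lerD2l lerDl mulr_ge0 ?expR_ge0.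
have := pos (- x); rewrite sqrrN oppr_ge0 (ltW x0) mulrN.
move=> /(_ isT) H; apply: le_trans H _.
by rewrite lerD2l lerDr mulr_ge0 ?expR_ge0.
Qed.

Section Noise.
Context {d : measure_display} {T : measurableType d} {R : realType}.
Variable P : probability T R.
Variables (n : nat) (X : 'I_n.+1 -> {RV P >-> R}) (s : R).
Hypothesis s_gt0 : 0 < s.
Hypothesis indX : independent_RVs X.
Hypothesis nX : forall i, normal_RV 0 s (X i).

(** Indexing by naturals allows cutting index intervals. Beyond [n] the value is the default of
    [inord]; the moment bounds keep their intervals below [n.+1]. *)
Definition noise (i : nat) (w : T) : R := X (inord i) w.

Local Notation S p q w := (\sum_(p <= l < q) noise l w).

Lemma mean_le_expR_noise (p q : nat) (a lam : R) : (q <= n.+1)%N ->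
  a ^+ 2 * (s ^+ 2 * (q - p)%:R) <= lam ^+ 2 ->
  mean_le P (fun w => expR (a * S p q w)) (expR (lam ^+ 2 / 2)).
Proof.
move=> qn alam.
have SE w : S p q w = \sum_(i < n.+1 | (p <= i < q)%N) X i w.
  rewrite (big_nat_ord_range p (fun l => noise l w) qn).
  by apply: eq_bigr => i _; rewrite /noise inord_val.
exists (fun w => expR (a * S p q w)); split => //.
  apply: measurableT_comp => //; apply: measurable_funM => //.
  by apply: measurable_sum => i; exact: measurable_funP.
under eq_integral do rewrite SE.
rewrite (independent_normal_mgf (s := s))//; last by rewrite gt_eqF.
rewrite lee_fin ler_expR.
have -> : #|(fun i : 'I_n.+1 => (p <= i < q)%N)| = (q - p)%N.
  by rewrite -sum1_card -(big_nat_ord_range p (fun=> 1%N) qn) sum_nat_const_nat muln1.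
by rewrite -mulr_natr; lra.
Qed.

(** Obtained from the exponential moments at [1 / r] and [- 1 / r], with [r] the standard deviation
    of the sum: 16 is [4 * (2 + 2)], as [expR (1 / 2) <= 2]. *)
Lemma mean_le_sqr_noise (p q : nat) : (q <= n.+1)%N ->
  mean_le P (fun w => S p q w ^+ 2) (16 * s ^+ 2 * (q - p)%:R).
Proof.
move=> qn; have [pq|qp] := ltnP p q; last first.
  apply: mean_leW (mean_le_cst P (lexx 0)) => [w|].
    by rewrite big_geq// expr0n.
  by move: qp; rewrite -subn_eq0 => /eqP ->; rewrite mulr0.
set N := (q - p)%:R : R.
have N0 : 0 < N by rewrite ltr0n subn_gt0.
pose r := Num.sqrt (s ^+ 2 * N).
have v0 : 0 < s ^+ 2 * N by rewrite mulr_gt0 ?exprn_gt0.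
have r0 : 0 < r by rewrite sqrtr_gt0.
have rr : r ^+ 2 = s ^+ 2 * N by rewrite sqr_sqrtr// ltW.
have e2 : expR (1 ^+ 2 / 2) <= 2 :> R.
  have := expR_ge1Dx (- (1 / 2) : R); have := expRxMexpNx_1 (1 / 2 : R).
  have := expR_gt0 (1 / 2 : R); rewrite expr1n; nra.
have m1 b : b ^+ 2 = r ^- 2 ->
    mean_le P (fun w => expR (b * S p q w)) (expR (1 ^+ 2 / 2)).
  move=> br; apply: mean_le_expR_noise => //.
  by rewrite br -rr expr1n mulVf// gt_eqF// exprn_gt0.
have := mean_leD (m1 r^-1 _) (m1 (- r^-1) _).
rewrite sqrrN exprVn => /(_ erefl erefl) /(mean_leZ (c := 4 * r ^+ 2)) H.
apply: mean_leW (H _) => [w||]; last by rewrite mulr_ge0// sqr_ge0.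
  have := sqr_le_expR (r^-1 * S p q w); rewrite exprMn mulNr => h.
  have -> : S p q w ^+ 2 = r ^+ 2 * (r^-1 ^+ 2 * S p q w ^+ 2).
    by rewrite mulrA -exprMn divff ?expr1n ?mul1r// gt_eqF.
  by rewrite [4 * _]mulrC -[leRHS]mulrA ler_wpM2l// sqr_ge0.
rewrite rr -/N; nra.
Qed.

(** [M] is a multiple of [Lam = 1 + ln k.+1] plus the sum of the exponential terms of
    [sqr_le_expR_tail] at [lam ^+ 2 = Lam]. Each of the [k.+1] terms has mean of order
    [expR (- Lam) / Lam], and [k.+1 * expR (- Lam)] is [expR (- 1)], so the sum stays bounded. The
    constant 21 comes from 9/2 + 16. *)
Lemma mean_le_max_family (k : nat) (p q : nat -> nat) :
  (forall i, (q i <= n.+1)%N) ->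
  exists M : T -> R,
  [/\ forall w, 0 <= M w,
      forall i w, (i < k.+1)%N ->
        S (p i) (q i) w ^+ 2 <= s ^+ 2 * (q i - p i)%:R * M w &
      mean_le P M (21 * (1 + ln k.+1%:R))].
Proof.
move=> qn.
pose N i := (q i - p i)%:R : R.
pose r i := Num.sqrt (s ^+ 2 * N i).
have v0 i : 0 <= s ^+ 2 * N i by rewrite mulr_ge0 ?exprn_ge0// ltW.
have rr i : r i ^+ 2 = s ^+ 2 * N i by rewrite sqr_sqrtr.
pose Lam := 1 + ln k.+1%:R : R.
have Lam1 : 1 <= Lam by rewrite lerDl ln_ge0// ler1n.
pose lam := Num.sqrt Lam.
have lam0 : 0 < lam by rewrite sqrtr_gt0; lra.
have lamE : lam ^+ 2 = Lam by rewrite sqr_sqrtr//; lra.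
pose c := 8 / Lam * expR (- (3 / 2 * Lam)).
have c0 : 0 <= c by rewrite !mulr_ge0 ?expR_ge0 ?invr_ge0; lra.
pose M w := 9 / 2 * Lam + c * \sum_(0 <= i < k.+1)
  (expR (lam / r i * S (p i) (q i) w) + expR (- (lam / r i) * S (p i) (q i) w)).
have M0 w : 0 <= M w.
  apply: addr_ge0; first by apply: mulr_ge0; lra.
  apply: mulr_ge0 => //.
  by apply: sumr_ge0 => i _; rewrite addr_ge0 ?expR_ge0.
exists M; split => //.
  move=> i w ik; have [ri|ri] := eqVneq (r i) 0.
    have : N i = 0.
      have := rr i; rewrite ri expr0n /= => /esym/eqP.
      by rewrite mulf_eq0 sqrf_eq0 gt_eqF//= => /eqP.
    move=> /eqP; rewrite pnatr_eq0 subn_eq0 => pq.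
    by rewrite big_geq// expr0n/=; apply: mulr_ge0 => //; exact: v0.
  rewrite -/(N i) -rr.
  have -> : S (p i) (q i) w ^+ 2 = r i ^+ 2 * ((r i)^-1 * S (p i) (q i) w) ^+ 2.
    by rewrite -exprMn mulrA divff ?mul1r.
  rewrite ler_wpM2l ?sqr_ge0//; apply: le_trans (sqr_le_expR_tail _ lam0) _.
  rewrite lamE /M lerD2l -/c ler_wpM2l//.
  have ii : i \in index_iota 0 k.+1 by rewrite mem_index_iota.
  rewrite (big_rem i ii)/=.
  rewrite -mulNr !mulrA mulNr lerDl; apply: sumr_ge0 => j _.
  by rewrite addr_ge0 ?expR_ge0.
have m1 i b : b ^+ 2 * r i ^+ 2 <= lam ^+ 2 ->
    mean_le P (fun w => expR (b * S (p i) (q i) w)) (expR (lam ^+ 2 / 2)).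
  by move=> br; apply: mean_le_expR_noise => //; rewrite -/(N i) -rr.
have m2 i : mean_le P (fun w => expR (lam / r i * S (p i) (q i) w) +
    expR (- (lam / r i) * S (p i) (q i) w)) (2 * expR (Lam / 2)).
  have lr : (lam / r i) ^+ 2 * r i ^+ 2 <= lam ^+ 2.
    have [->|ri] := eqVneq (r i) 0; first by rewrite expr0n/= mulr0 sqr_ge0.
    by rewrite -exprMn divfK.
  rewrite mulr_natl mulr2n -lamE; apply: mean_leD; apply: m1 => //.
  by rewrite sqrrN.
have := mean_le_sum (index_iota 0 k.+1) (D := predT) (fun i _ => m2 i).
move=> /(mean_leZ c0) H.
have B0 : 0 <= 9 / 2 * Lam by lra.
apply: mean_leW (mean_leD (mean_le_cst P B0) H) => //.
rewrite sumr_const_nat subn0 -[1 + _]/Lam -[_ *+ k.+1]mulr_natl.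
have -> : k.+1%:R * (2 * expR (Lam / 2)) = 2 * expR (Lam / 2 + (Lam - 1)).
  rewrite expRD /Lam [1 + ln _ - 1]addrAC subrr add0r lnK ?posrE ?ltr0n//.
  by ring.
have -> : c * (2 * expR (Lam / 2 + (Lam - 1))) = 16 / Lam * expR (- 1).
  rewrite [X in _ = _ * expR X](_ : _ =
    - (3 / 2 * Lam) + (Lam / 2 + (Lam - 1))); last by field.
  by rewrite [in RHS]expRD /c; ring.
have e1 : expR (- 1) <= 1 :> R by rewrite -[leRHS]expR0 ler_expR; lra.
have : 16 / Lam * expR (-1) <= 16.
  rewrite -mulrA ger_pMr// mulr_ile1 ?expR_ge0 ?invr_ge0 ?invf_le1//; lra.
lra.
Qed.

(** Pairs of endpoints are coded as [p * n.+2 + q]. There are [n.+2 ^ 2] of them, and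
    [n.+2 <= n.+1 ^ 2] for [n > 0], which gives the factor 4 in 84 = 4 * 21. *)
Lemma mean_le_max_noise : (0 < n)%N ->
  exists M : T -> R,
  [/\ forall w, 0 <= M w,
      forall p q w, (p <= n.+1)%N -> (q <= n.+1)%N ->
        S p q w ^+ 2 <= s ^+ 2 * (q - p)%:R * M w &
      mean_le P M (84 * (1 + ln n.+1%:R))].
Proof.
move=> n0; pose k := (n.+2 * n.+2).-1.
have kE : k.+1 = (n.+2 * n.+2)%N by [].
have [M [M0 MS mM]] := @mean_le_max_family k (fun i => i %/ n.+2)%N
  (fun i => i %% n.+2)%N (fun i => ltn_pmod i (ltn0Sn _)).
exists M; split => //.
  move=> p q w pn qn; have := MS (p * n.+2 + q)%N w.
  rewrite divnMDl// divn_small// addn0 modnMDl modn_small//; apply.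
  rewrite kE; apply: leq_trans (_ : p.+1 * n.+2 <= _)%N.
    by rewrite mulSn addnC -addSn leq_add2r.
  by rewrite leq_mul2r.
apply: mean_leW mM => //.
have : ln k.+1%:R <= 4 * ln n.+1%:R :> R; last first.
  have : 0 <= ln n.+1%:R :> R by rewrite ln_ge0// ler1n.
  lra.
rewrite kE natrM lnM ?posrE ?ltr0n//.
have : ln n.+2%:R <= ln (n.+1%:R ^+ 2) :> R.
  rewrite ler_ln ?posrE ?exprn_gt0 ?ltr0n// -natrX ler_nat.
  by rewrite -mulnn mulSn; nlia.
by rewrite lnXn ?ltr0n// mulr2n; lra.
Qed.

(** Cauchy-Schwarz, from the nonnegativity of the squared deviations from the average. *)
Lemma sqr_sum_le (a : nat -> R) p q :
  (\sum_(p <= i < q) a i) ^+ 2 <= (q - p)%:R * \sum_(p <= i < q) a i ^+ 2.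
Proof.
have [pq|qp] := ltnP p q; last by rewrite !big_geq// expr0n/= mulr0.
set N := (q - p)%N; set A := \sum_(p <= i < q) a i.
have N0 : 0 < N%:R :> R by rewrite ltr0n subn_gt0.
have : 0 <= \sum_(p <= i < q) (a i - A / N%:R) ^+ 2.
  by apply: sumr_ge0 => i _; exact: sqr_ge0.
have -> : \sum_(p <= i < q) (a i - A / N%:R) ^+ 2 =
    \sum_(p <= i < q) a i ^+ 2 - 2 * (A / N%:R) * A + N%:R * (A / N%:R) ^+ 2.
  have -> : 2 * (A / N%:R) * A = \sum_(p <= i < q) 2 * (A / N%:R) * a i.
    by rewrite -mulr_sumr.
  have -> : N%:R * (A / N%:R) ^+ 2 = \sum_(p <= i < q) (A / N%:R) ^+ 2.
    by rewrite sumr_const_nat -[RHS]mulr_natl.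
  rewrite -sumrB -big_split /=; apply: eq_bigr => i _; ring.
move=> H.
set U := \sum_(p <= i < q) a i ^+ 2 in H *.
have : 0 <= N%:R * (U - 2 * (A / N%:R) * A + N%:R * (A / N%:R) ^+ 2).
  by rewrite mulr_ge0// ltW.
have -> : N%:R * (U - 2 * (A / N%:R) * A + N%:R * (A / N%:R) ^+ 2) =
    N%:R * U - A ^+ 2 by field; rewrite gt_eqF.
by rewrite subr_ge0.
Qed.

Lemma tails_sqr_le (e : nat -> R) p q : tails e p q ^+ 2 <=
  2 * (q - p)%:R ^+ 2 * (\sum_(p <= l < q) e l) ^+ 2 +
  2 * (q - p)%:R * \sum_(p <= i < q) (\sum_(i <= l < q) e l) ^+ 2.
Proof.
rewrite /tails; set N := (q - p)%:R; set A := \sum_(p <= i < q) `|_|.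
have : A ^+ 2 <= N * \sum_(p <= i < q) (\sum_(i <= l < q) e l) ^+ 2.
  apply: le_trans (sqr_sum_le _ _ _) _; rewrite -/N; apply: ler_wpM2l => //.
  by apply: ler_sum => i _; rewrite real_normK ?num_real.
move: (\sum_(p <= i < q) _) => U AU; set t := \sum_(p <= l < q) e l.
have := sqr_ge0 (N * `|t| - A).
have : (N * `|t|) ^+ 2 = N ^+ 2 * t ^+ 2 by rewrite exprMn real_normK ?num_real.
move: (N * `|t|) => v vE; rewrite -[2 * N ^+ 2 * _]mulrA -vE -mulrA; nra.
Qed.

(** Each partial sum in [tails] has second moment at most [16 * s ^+ 2 * N], so the square of
    [tails] is of order [s ^+ 2 * N ^+ 3]. The full sum and the inner sums each contribute 32. *)
Lemma mean_le_energy p q : (q <= n.+1)%N ->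
  mean_le P (fun w => energy (noise ^~ w) p q) (64 * s ^+ 2).
Proof.
move=> qn; have s20 : 0 <= s ^+ 2 := sqr_ge0 s.
have [pq|qp] := ltnP p q; last first.
  apply: mean_leW (mean_le_cst P (lexx 0)) => [w|]; last by rewrite mulr_ge0.
  by move: qp; rewrite /energy -subn_eq0 => /eqP ->; rewrite expr0n/= invr0 mulr0.
set N := (q - p)%:R : R.
have N0 : 0 < N by rewrite ltr0n subn_gt0.
have c1 : 0 <= 2 / N by rewrite divr_ge0// ltW.
have c2 : 0 <= 2 / N ^+ 2 by rewrite divr_ge0// exprn_ge0// ltW.
have m1 := mean_leZ c1 (mean_le_sqr_noise p qn).
have m2 := mean_leZ c2 (mean_le_sum (index_iota p q) (D := predT)
  (fun i _ => mean_le_sqr_noise i qn)).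
apply: mean_leW (mean_leD m1 m2) => [w|].
  rewrite /energy -/N ler_pdivrMr ?exprn_gt0//.
  apply: le_trans (tails_sqr_le _ _ _) _; rewrite -/N le_eqVlt; apply/orP; left.
  by apply/eqP; field; rewrite gt_eqF.
have -> : 64 * s ^+ 2 = 2 / N * (16 * s ^+ 2 * N) + 2 / N ^+ 2 * (16 * s ^+ 2 * N * N).
  by field; rewrite gt_eqF.
rewrite -/N lerD2l ler_wpM2l//.
apply: le_trans (_ : \sum_(p <= i < q) 16 * s ^+ 2 * N <= _).
  apply: ler_sum_nat => i /andP[pi iq]; apply: ler_wpM2l; first by rewrite mulr_ge0.
  by rewrite ler_nat leq_sub2l.
by rewrite sumr_const_nat -/N -[leLHS]mulr_natr.
Qed.
End Noise.

(** * Risk bounds *)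

Section Deterministic.
Context {R : realType}.
Implicit Types (f phi psi al : R -> R).

Lemma convex01P f : convex01 f -> forall a c t : R,
  0 <= a <= 1 -> 0 <= c <= 1 -> 0 <= t <= 1 ->
  f (t * a + (1 - t) * c) <= t * f a + (1 - t) * f c.
Proof.
move=> cf a c t a01 c01 /andP[t0 t1].
have := cf (Itv01 t0 t1) a c.
by rewrite !inE /= !in_itv /= a01 c01 => /(_ isT isT).
Qed.

Lemma convex01_increments f (a b c : R) : convex01 f ->
  0 <= a -> a < b -> b < c -> c <= 1 ->
  (f b - f a) * (c - b) <= (f c - f b) * (b - a).
Proof.
move=> cf a0 ab bc c1; have ca : 0 < c - a by lra.
have := @convex01P f cf a c ((c - b) / (c - a)).
have -> : (c - b) / (c - a) * a + (1 - (c - b) / (c - a)) * c = b.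
  by field; rewrite gt_eqF.
have t1 : 0 <= (c - b) / (c - a) <= 1.
  by rewrite divr_ge0 ?ler_pdivrMr//; lra.
have a1 : 0 <= a <= 1 by lra.
have c01 : 0 <= c <= 1 by lra.
move=> /(_ a1 c01 t1); rewrite -(ler_pM2l ca).
rewrite (_ : (c - a) * (_ * f a + _) = (c - b) * f a + (b - a) * f c).
  by nra.
by field; rewrite gt_eqF.
Qed.

Variables (n : nat) (x : 'I_n.+1 -> R) (c1 c2 : R).
Hypothesis c1_gt0 : 0 < c1.
Hypothesis x01 : forall i, 0 <= x i <= 1.
Hypothesis xgap : forall i j : 'I_n.+1, nat_of_ord j = (nat_of_ord i).+1 ->
  c1 <= n.+1%:R * (x j - x i) <= c2.
Hypothesis c12 : c1 <= c2.

Definition design (i : nat) : R := x (inord i).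

Let X := design.

(* Gaps are measured in units of [c1 / n], and padded by 1 past the design. *)
Definition design_gap (i : nat) : R :=
  if (i.+1 < n.+1)%N then n.+1%:R * (X i.+1 - X i) / c1 else 1.

Let gap := design_gap.
Let K := c2 / c1.

Lemma design_gapP i : 1 <= gap i <= K.
Proof.
rewrite /gap /design_gap; case: ifPn => [ni|_].
  have := xgap (i := inord i) (j := inord i.+1).
  rewrite !inordK//; last exact: ltnW.
  move=> /(_ erefl) /andP[h1 h2].
  by rewrite /K ler_pdivlMr// mul1r h1/= ler_pM2r ?invr_gt0.
by rewrite lexx /K ler_pdivlMr// mul1r.
Qed.

Lemma design_lt i : (i.+1 < n.+1)%N -> X i < X i.+1.
Proof.
move=> ni; have := design_gapP i; rewrite /gap /design_gap ni => /andP[h _].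
have : 0 < n.+1%:R * (X i.+1 - X i) / c1 by apply: lt_le_trans h.
by rewrite pmulr_lgt0 ?invr_gt0// pmulr_rgt0 ?ltr0n// subr_gt0.
Qed.

Lemma design01 i : 0 <= X i <= 1. Proof. exact: x01. Qed.

Lemma slopes_nondecreasing_step (g : nat -> R) p q :
  (forall i, (p <= i)%N -> (i.+2 < q)%N -> slope gap g i <= slope gap g i.+1) ->
  slopes_nondecreasing gap g p q.
Proof.
move=> H i j pi ij jq; rewrite -(subnKC ij) in jq *.
elim: (j - i)%N jq => [|h IH] jq; first by rewrite addn0.
rewrite addnS in jq *; apply: le_trans (IH _) (H _ _ _); nlia.
Qed.

Lemma convex01_slopes f : convex01 f ->
  slopes_nondecreasing gap (f \o X) 0 n.+1.
Proof.
move=> cf; apply: slopes_nondecreasing_step => i _ iq.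
have i1 : (i.+1 < n.+1)%N by nlia.
have h1 := design_lt i1; have h2 := design_lt iq.
have := convex01_increments cf (andP (design01 i)).1 h1 h2 (andP (design01 i.+2)).2.
rewrite /slope /gap /design_gap i1 iq /=.
set u := X i.+1 - X i; set v := X i.+2 - X i.+1 => H.
have u0 : 0 < u by rewrite subr_gt0.
have v0 : 0 < v by rewrite subr_gt0.
have n0 : 0 < n.+1%:R :> R by rewrite ltr0n.
rewrite ler_pdivrMr ?divr_gt0 ?mulr_gt0// mulrAC ler_pdivlMr ?divr_gt0 ?mulr_gt0//.
have cn : 0 < n.+1%:R / c1 by rewrite divr_gt0.
rewrite (_ : n.+1%:R * v / c1 = n.+1%:R / c1 * v); last by ring.
rewrite (_ : n.+1%:R * u / c1 = n.+1%:R / c1 * u); last by ring.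
by rewrite mulrCA [leRHS]mulrCA ler_wpM2l// ltW.
Qed.

(** Relative to the gaps an affine function has a constant slope, so subtracting it keeps slopes
    monotone. Affinity is asked at [i] and [i.+1] only, which allows one affine piece at a time. *)
Lemma slopeB_affine (f g : nat -> R) (a b : R) i :
  g i = a * X i + b -> g i.+1 = a * X i.+1 + b -> (i.+1 < n.+1)%N ->
  slope gap (fun i => f i - g i) i = slope gap f i - a * c1 / n.+1%:R.
Proof.
move=> gi gi1 ni; rewrite /slope gi gi1 /gap /design_gap ni.
have n0 : n.+1%:R != 0 :> R by rewrite pnatr_eq0.
have := design_lt ni; rewrite -subr_gt0 => /lt0r_neq0 h.
move: (n.+1%:R : R) n0 => N N0.
by field; rewrite h N0 gt_eqF.
Qed.

Lemma ell2E phi psi : ell2 x phi psi =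
  n.+1%:R^-1 * nrm2 (fun i => phi (X i) - psi (X i)) 0 n.+1.
Proof.
rewrite /ell2 /nrm2 big_mkord; congr (_ * _); apply: eq_bigr => i _.
by rewrite /X /design inord_val.
Qed.

Lemma lse_basic_inequality (e : nat -> R) (y : 'I_n.+1 -> R) phi psi chi :
  (forall i : 'I_n.+1, y i = phi (x i) + e i) -> is_lse x y psi -> convex01 chi ->
  nrm2 (fun i => phi (X i) - psi (X i)) 0 n.+1 <=
  nrm2 (fun i => phi (X i) - chi (X i)) 0 n.+1 +
  2 * \sum_(0 <= i < n.+1) (psi (X i) - chi (X i)) * e i.
Proof.
move=> yE [_ /(_ chi) H] cchi; have := H cchi; rewrite /rss => {}H.
rewrite /nrm2 !big_mkord -subr_ge0; move: H; rewrite -subr_ge0.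
rewrite mulr_sumr -big_split -!sumrB /= => H; apply: le_trans H _.
rewrite le_eqVlt; apply/orP; left; apply/eqP; apply: eq_bigr => i _.
by rewrite yE /X /design inord_val; ring.
Qed.

End Deterministic.

(** Empty blocks may be appended, so that intervals of different lengths share one number of
    blocks. *)
Lemma whitney_widen a b k k' c : (k <= k')%N -> whitney a b k c -> whitney a b k' c.
Proof.
move=> kk [c0 cb mc wc]; split=> //.
  by move=> i ki; apply: cb; exact: leq_trans ki.
move=> i ik' sz; apply: wc => //; rewrite ltnNge; apply/negP => ki.
by move: sz; rewrite !cb ?subnn//; exact: leqW.
Qed.

Lemma affine_pieces_gt0 (R : realType) k (f : R -> R) :
  affine_pieces k f -> (0 < k)%N.
Proof.
by case: k => // -[t [t0 t1 _ _]]; move: t1; rewrite t0 => /eqP; rewrite eq_sym oner_eq0.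
Qed.

(** * Mean risk against piecewise affine and affine functions *)

Section Risk.
Context {d : measure_display} {T : measurableType d} {R : realType}.
Variable P : probability T R.
Variables (n : nat) (x : 'I_n.+1 -> R) (c1 c2 s : R).
Hypothesis c1_gt0 : 0 < c1.
Hypothesis x01 : forall i, 0 <= x i <= 1.
Hypothesis xgap : forall i j : 'I_n.+1, nat_of_ord j = (nat_of_ord i).+1 ->
  c1 <= n.+1%:R * (x j - x i) <= c2.
Hypothesis c12 : c1 <= c2.
Variable xi : 'I_n.+1 -> {RV P >-> R}.
Hypothesis s_gt0 : 0 < s.
Hypothesis indxi : independent_RVs xi.
Hypothesis nxi : forall i, normal_RV 0 s (xi i).

Let X := design x.
Let gap := design_gap x c1.
Let K := c2 / c1.
Let gapK : forall i, 1 <= gap i <= K := design_gapP c1_gt0 xgap c12.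
Let K1 : 1 <= K. Proof. by rewrite /K ler_pdivlMr// mul1r. Qed.
Let K0 : 0 < K. Proof. exact: lt_le_trans ltr01 K1. Qed.
Let e (w : T) (i : nat) : R := noise xi i w.

Definition num_blocks : nat := 2 * trunc_log 2 n.+1 + 3.

Let X_le i j : (i <= j)%N -> (j < n.+1)%N -> X i <= X j.
Proof.
move=> /subnKC <-; elim: (j - i)%N => [|h IH]; first by rewrite addn0.
rewrite addnS => jn; apply: le_trans (IH (ltnW jn)) (ltW _).
exact: (design_lt c1_gt0 xgap c12).
Qed.

Lemma affine_pieces_cuts k (f : R -> R) : affine_pieces k f ->
  exists a : nat -> nat, [/\ a 0%N = 0%N, a k = n.+1, forall r, (a r <= a r.+1)%N,
    forall r, (a r <= n.+1)%N &
    forall r, (r < k)%N -> exists al be, forall i, (a r <= i)%N ->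
      (i < a r.+1)%N -> f (X i) = al * X i + be].
Proof.
move=> fk; have k0 := affine_pieces_gt0 fk; have [t [t0 tk mt ft]] := fk.
(* The first design point at or beyond [t r]. The last cut is [n.+1], so that a design point equal
   to [t k = 1] belongs to the last piece. *)
pose a r := if (r < k)%N then find (fun i => t r <= X i) (iota 0 n.+1) else n.+1.
have an r : (a r <= n.+1)%N.
  by rewrite /a; case: ifP => // _; rewrite -{2}(size_iota 0 n.+1) find_size.
have a_lt r i : (r < k)%N -> (i < a r)%N -> X i < t r.
  move=> rk ia; have ni : (i < n.+1)%N := leq_trans ia (an r).
  move: ia; rewrite /a rk => /(before_find 0%N).
  by rewrite nth_iota// add0n => /negbT; rewrite -ltNge.
have a_ge r i : (r < k)%N -> (a r <= i)%N -> (i < n.+1)%N -> t r <= X i.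
  move=> rk ai ni; have an' : (a r < n.+1)%N := leq_ltn_trans ai ni.
  apply: le_trans (X_le ai ni); have := an'; rewrite /a rk => fi.
  have := nth_find 0%N (a := fun i => t r <= X i) (s := iota 0 n.+1).
  by rewrite has_find size_iota fi nth_iota// => /(_ isT).
exists a; split => //.
- rewrite /a k0 t0 /= ifT//.
  by have /andP[] := design01 x01 0.
- by rewrite /a ltnn.
- move=> r; have [rk|rk] := ltnP r.+1 k; last first.
    by rewrite {2}/a ltnNge rk.
  rewrite leqNgt; apply/negP => lt.
  have ni : (a r.+1 < n.+1)%N := leq_trans lt (an r).
  have := a_lt r _ (ltnW rk) lt; have := a_ge r.+1 _ rk (leqnn _) ni.
  by have := mt r (ltnW rk); lra.
- move=> r rk; have [al [be fE]] := ft r rk; exists al, be => i ai ia.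
  have ni : (i < n.+1)%N := leq_trans ia (an _).
  apply: fE; rewrite /= in_itv /= (a_ge r)//=.
  have [rk'|rk'] := ltnP r.+1 k; first exact/ltW/a_lt.
  have -> : r.+1 = k by nlia.
  by rewrite tk; have /andP[] := design01 x01 i.
Qed.

Variables (phi : R -> R) (psi : T -> R -> R).
Hypothesis lse : forall w, is_lse x (fun i => phi (x i) + xi i w) (psi w).

Let basic w chi : convex01 chi ->
  nrm2 (fun i => phi (X i) - psi w (X i)) 0 n.+1 <=
  nrm2 (fun i => phi (X i) - chi (X i)) 0 n.+1 +
  2 * \sum_(0 <= i < n.+1) (psi w (X i) - chi (X i)) * e w i.
Proof.
apply: lse_basic_inequality (lse w) => i.
by rewrite /e /noise inord_val.
Qed.

Let risk w := nrm2 (fun i => phi (X i) - psi w (X i)) 0 n.+1.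

Lemma mean_le_ell2 (v : R) : mean_le P risk v ->
  mean_le P (fun w => ell2 x (psi w) phi) (v / n.+1%:R).
Proof.
have n0 : 0 <= n.+1%:R^-1 :> R by rewrite invr_ge0.
move=> /(mean_leZ n0); rewrite mulrC; apply: mean_leW => // w.
rewrite ell2E le_eqVlt; apply/orP; left; apply/eqP; congr (_ * _).
by apply: eq_bigr => i _; rewrite -sqrrN opprB.
Qed.

(** Convexity of [psi w - al] is available only between the breakpoints of [al], so each affine
    piece receives its own Whitney blocks. *)
Lemma mean_le_risk_pieces al k : convex01 al -> affine_pieces k al ->
  mean_le P (fun w => ell2 x (psi w) phi)
    (3 * ell2 x phi al + 2 ^+ 29 * K ^+ 2 * num_blocks%:R * k%:R * s ^+ 2 / n.+1%:R).
Proof.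
move=> cal kal; have [a [a0 ak ma an aal]] := affine_pieces_cuts kal.
have /choice[c cP] : forall r, exists cr, whitney (a r) (a r.+1) num_blocks cr.
  move=> r; have [cr] := whitney_exists (a r) (a r.+1 - a r); rewrite subnKC// => W.
  exists cr; apply: whitney_widen W; rewrite leq_add2r leq_mul2l /=.
  by apply: leq_trunc_log; exact: leq_trans (leq_subr _ _) (an _).
pose Z w := \sum_(0 <= r < k) \sum_(0 <= i < num_blocks)
  energy (e w) (c r i) (c r i.+1).
have mZ : mean_le P Z (k%:R * (num_blocks%:R * (64 * s ^+ 2))).
  have := mean_le_sum (index_iota 0 k) (D := predT) (fun r _ =>
    mean_le_sum (index_iota 0 num_blocks) (D := predT) (fun i _ =>
      mean_le_energy s_gt0 indxi nxi (c r i)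
        (leq_trans (andP (whitney_bounds i.+1 (cP r))).2 (an r.+1)))).
  by rewrite !sumr_const_nat !subn0 -[_ *+ k]mulr_natl -[_ *+ num_blocks]mulr_natl.
have pw w : risk w <= 3 * nrm2 (fun i => phi (X i) - al (X i)) 0 n.+1 +
    2 ^+ 23 * K ^+ 2 * Z w.
  set A := nrm2 _ _ _; pose g i := psi w (X i) - al (X i).
  (* Twice the noise term then costs [A / 2 + risk w / 2]. The half risk moves to the left, and
     doubling gives the factor 3 in front of [A]. *)
  have e8 : 0 < 1 / 8 :> R by lra.
  have piece_le r : (0 <= r < k)%N -> `|\sum_(a r <= i < a r.+1) g i * e w i| <=
      1 / 8 * nrm2 g (a r) (a r.+1) + 2 ^+ 18 * K ^+ 2 / (1 / 8) *
      \sum_(0 <= i < num_blocks) energy (e w) (c r i) (c r i.+1).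
    move=> /andP[_ rk]; apply: (convex_pairing gapK _ e8 (cP r)) => i j ai ij ja.
    have [u [v alE]] := aal r rk.
    have sl l : (a r <= l)%N -> (l.+1 < a r.+1)%N ->
        slope gap g l = slope gap (psi w \o X) l - u * c1 / n.+1%:R.
      move=> al_ la; apply: (slopeB_affine c1_gt0 xgap c12 (psi w \o X)
        (alE l al_ (ltnW la)) (alE l.+1 (leqW al_) la)).
      exact: leq_trans la (an _).
    rewrite !sl; [|by nlia..]; rewrite lerD2r.
    apply: (convex01_slopes c1_gt0 x01 xgap c12 (lse w).1) => //.
    exact: leq_trans ja (an _).
  have noise_le : \sum_(0 <= i < n.+1) g i * e w i <=
      1 / 8 * nrm2 g 0 n.+1 + 2 ^+ 18 * K ^+ 2 / (1 / 8) * Z w.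
    rewrite -{1}a0 -{1}ak -(sum_cuts k (fun i => g i * e w i) ma).
    apply: le_trans (ler_norm _) _; apply: le_trans (ler_norm_sum _ _ _) _.
    apply: le_trans (ler_sum_nat piece_le) _.
    rewrite big_split /= -!mulr_sumr lerD2r /nrm2.
    by rewrite (sum_cuts k (fun i => g i ^+ 2) ma) a0 ak.
  have gle : nrm2 g 0 n.+1 <= 2 * A + 2 * risk w.
    have -> : nrm2 g 0 n.+1 = nrm2 (fun i => (phi (X i) - al (X i)) +
        - (phi (X i) - psi w (X i))) 0 n.+1.
      by apply: eq_bigr => i _; rewrite /g; congr (_ ^+ 2); ring.
    apply: le_trans (nrm2_addl _ _ _ _) _.
    rewrite lerD2l ler_wpM2l// le_eqVlt; apply/orP; left; apply/eqP.
    by apply: eq_bigr => i _; rewrite sqrrN.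
  have := basic w cal; rewrite -/A -/(risk w) => H.
  have E : 2 ^+ 18 * K ^+ 2 / (1 / 8) * Z w = 2 ^+ 21 * K ^+ 2 * Z w by field.
  rewrite E in noise_le.
  have E2 : 2 ^+ 23 * K ^+ 2 * Z w = 4 * (2 ^+ 21 * K ^+ 2 * Z w) by ring.
  rewrite E2; move: (2 ^+ 21 * K ^+ 2 * Z w) noise_le => V; rewrite /g; lra.
have A0 : 0 <= 3 * nrm2 (fun i => phi (X i) - al (X i)) 0 n.+1.
  by rewrite mulr_ge0 ?nrm2_ge0.
have Z0 : 0 <= 2 ^+ 23 * K ^+ 2 by rewrite mulr_ge0 ?exprn_ge0 ?(ltW K0).
have := mean_leD (mean_le_cst P A0) (mean_leZ Z0 mZ) => mr.
apply: mean_leW (mean_le_ell2 (mean_leW pw (lexx _) mr)) => //.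
rewrite ell2E le_eqVlt; apply/orP; left; apply/eqP.
have n0 : n.+1%:R != 0 :> R by rewrite pnatr_eq0.
by move: (n.+1%:R : R) n0 => N N0; field.
Qed.

(** With [phi] as competitor the approximation term vanishes and only the noise remains. Subtracting
    [tau] from both functions leaves their difference unchanged, and the norm of [phi - tau] then
    controls the slopes. The pieces need a common bound on [tails], hence the maximum [M]. *)
Lemma mean_le_risk_affine tau m (lam : R) : (0 < n)%N -> (0 < m)%N -> 0 < lam ->
  convex01 phi -> affine_on `[0, 1]%classic tau ->
  mean_le P (fun w => ell2 x (psi w) phi)
    ((2 ^+ 18 * K ^+ 2 * num_blocks%:R * m%:R * s ^+ 2 +
      2 ^+ 8 * K * lam / m%:R ^+ 3 * (n.+1%:R * ell2 x phi tau) +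
      num_blocks%:R * s ^+ 2 * (1 + ln n.+1%:R) *
        (2 ^+ 30 * K / lam + 2 ^+ 39 * K ^+ 2 / m%:R ^+ 3)) / n.+1%:R).
Proof.
move=> npos m0 lam0 cphi [al [be tauE]].
have mR0 : 0 < m%:R ^+ 3 :> R by rewrite exprn_gt0// ltr0n.
have [c cP] : exists c, whitney 0 n.+1 num_blocks c by exact: whitney_exists.
have cn i : (c i <= n.+1)%N by have /andP[] := whitney_bounds i cP.
pose pc i j := piece (c i) (c i.+1) m j.
have pcn i j : (pc i j <= n.+1)%N.
  exact: leq_trans (geq_minr _ _) (cn _).
have [M [M0 MS mM]] := mean_le_max_noise s_gt0 indxi nxi npos.
pose Z w := \sum_(0 <= i < num_blocks) \sum_(0 <= j < m)
  energy (e w) (pc i j) (pc i j.+1).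
have mZ : mean_le P Z (num_blocks%:R * (m%:R * (64 * s ^+ 2))).
  have := mean_le_sum (index_iota 0 num_blocks) (D := predT) (fun i _ =>
    mean_le_sum (index_iota 0 m) (D := predT) (fun j _ =>
      mean_le_energy s_gt0 indxi nxi (pc i j) (pcn i j.+1))).
  by rewrite !sumr_const_nat !subn0 -[_ *+ m]mulr_natl -[_ *+ num_blocks]mulr_natl.
pose A := nrm2 (fun i => phi (X i) - tau (X i)) 0 n.+1.
have tails_le w p q : (q <= n.+1)%N -> tails (e w) p q ^+ 2 <=
    4 * s ^+ 2 * M w * (q - p)%:R ^+ 3.
  move=> qn; apply: le_trans (tails_sqr_le _ _ _) _.
  set N := (q - p)%:R : R; have N0 : 0 <= N := ler0n _ _.
  have [pq|qp] := leqP p q; last first.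
    rewrite /N; have -> : (q - p = 0)%N by apply/eqP; rewrite subn_eq0 ltnW.
    by rewrite !expr0n /= !(mulr0, mul0r) addr0.
  have h1 := MS p q w (leq_trans pq qn) qn.
  have h2 : \sum_(p <= i < q) (\sum_(i <= l < q) e w l) ^+ 2 <=
      N * (s ^+ 2 * N * M w).
    rewrite mulr_natl -(sumr_const_nat q p); apply: ler_sum_nat => i /andP[pi iq].
    apply: le_trans (MS i q w (leq_trans (ltnW iq) qn) qn) _.
    apply: ler_wpM2r => //; apply: ler_wpM2l; first exact: sqr_ge0.
    by rewrite ler_nat leq_sub2l.
  have N2 : 0 <= 2 * N ^+ 2 by rewrite mulr_ge0 ?exprn_ge0.
  have N3 : 0 <= 2 * N by rewrite mulr_ge0.
  have := lerD (ler_wpM2l N2 h1) (ler_wpM2l N3 h2).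
  move=> H; apply: le_trans H _; rewrite -/N le_eqVlt; apply/orP; left.
  by apply/eqP; ring.
have pw w : risk w <= 2 ^+ 12 * K ^+ 2 * Z w + 2 ^+ 8 * K * lam / m%:R ^+ 3 * A +
    num_blocks%:R * (4 * s ^+ 2 *
      (2 ^+ 21 * K / lam + 2 ^+ 30 * K ^+ 2 / m%:R ^+ 3)) * M w.
  pose f i := psi w (X i) - tau (X i); pose g i := phi (X i) - tau (X i).
  have affine_slopes h : convex01 h ->
      slopes_nondecreasing gap (fun i => h (X i) - tau (X i)) 0 n.+1.
    move=> ch i j _ ij jn.
    have tE l : tau (X l) = al * X l + be.
      by apply: tauE; rewrite /= in_itv /=; exact: design01.
    have sl l : (l.+1 < n.+1)%N ->
        slope gap (fun i => h (X i) - tau (X i)) l =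
        slope gap (h \o X) l - al * c1 / n.+1%:R.
      by move=> ln; rewrite (slopeB_affine c1_gt0 xgap c12 (h \o X) (tE l) (tE l.+1)).
    rewrite !sl; [|by nlia..]; rewrite lerD2r.
    exact: (convex01_slopes c1_gt0 x01 xgap c12 ch).
  have y0 : 0 <= 4 * s ^+ 2 * M w by rewrite mulr_ge0 ?mulr_ge0 ?exprn_ge0 ?(ltW s_gt0).
  (* Half of the risk is absorbed on the left, whence the factors 4 below. *)
  have e4 : 0 < 1 / 4 :> R by lra.
  have := pairing_refined (e := e w) gapK m0 e4 lam0 y0 cP
    (affine_slopes _ (lse w).1) (affine_slopes _ cphi)
    (fun i j _ _ => tails_le w (pc i j) (pc i j.+1) (pcn i j.+1)).
  rewrite -/(Z w) -/A; set h := fun l => _ - _ : R => H.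
  have hE l : h l = psi w (X l) - phi (X l) by rewrite /h; ring.
  have nh : nrm2 h 0 n.+1 = risk w.
    by apply: eq_bigr => i _; rewrite hE -sqrrN opprB.
  rewrite nh in H; have := basic w cphi.
  rewrite [X in _ <= X + _](_ : _ = 0) ?add0r; last first.
    by rewrite /nrm2 big1// => i _; rewrite subrr expr0n.
  have -> : \sum_(0 <= i < n.+1) (psi w (X i) - phi (X i)) * e w i =
      \sum_(0 <= i < n.+1) (psi w (X i) - tau (X i) - (phi (X i) - tau (X i))) * e w i.
    by apply: eq_bigr => i _; congr (_ * _); ring.
  have := ler_norm (\sum_(0 <= i < n.+1)
    (psi w (X i) - tau (X i) - (phi (X i) - tau (X i))) * e w i).
  rewrite -/(risk w); move: (\sum_(0 <= i < n.+1) _) H => U H HU HR.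
  have E1 : 2 ^+ 8 * K ^+ 2 / (1 / 4) * Z w = 2 ^+ 10 * K ^+ 2 * Z w by field.
  have mn : m%:R != 0 :> R by rewrite pnatr_eq0 -lt0n.
  have E2 : 2 ^+ 19 * K * (4 * s ^+ 2 * M w) / lam +
      2 ^+ 26 * K ^+ 2 * (4 * s ^+ 2 * M w) / (1 / 4 * m%:R ^+ 3) =
      4 * s ^+ 2 * (2 ^+ 19 * K / lam + 2 ^+ 28 * K ^+ 2 / m%:R ^+ 3) * M w.
    by field; rewrite mn gt_eqF.
  rewrite E1 E2 in H.
  have {}HU : U <= _ := le_trans HU H.
  have -> : 2 ^+ 12 * K ^+ 2 * Z w = 4 * (2 ^+ 10 * K ^+ 2 * Z w) by ring.
  have -> : 2 ^+ 8 * K * lam / m%:R ^+ 3 * A = 4 * (2 ^+ 6 * K * lam / m%:R ^+ 3 * A).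
    by ring.
  have -> : num_blocks%:R * (4 * s ^+ 2 *
      (2 ^+ 21 * K / lam + 2 ^+ 30 * K ^+ 2 / m%:R ^+ 3)) * M w =
    4 * (num_blocks%:R * (4 * s ^+ 2 *
      (2 ^+ 19 * K / lam + 2 ^+ 28 * K ^+ 2 / m%:R ^+ 3) * M w)) by ring.
  move: (2 ^+ 10 * K ^+ 2 * Z w) (2 ^+ 6 * K * lam / m%:R ^+ 3 * A)
    (num_blocks%:R * _) HU => V1 V2 V3 {}HU; lra.
have A0 : 0 <= 2 ^+ 8 * K * lam / m%:R ^+ 3 * A.
  apply: mulr_ge0; last exact: nrm2_ge0.
  apply: divr_ge0 (ltW mR0); apply: mulr_ge0 (ltW lam0).
  by apply: mulr_ge0 (ltW K0); exact: exprn_ge0.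
have Z0 : 0 <= 2 ^+ 12 * K ^+ 2 by rewrite mulr_ge0 ?exprn_ge0 ?(ltW K0).
have Mc0 : 0 <= num_blocks%:R * (4 * s ^+ 2 *
      (2 ^+ 21 * K / lam + 2 ^+ 30 * K ^+ 2 / m%:R ^+ 3)).
  apply: mulr_ge0 => //; apply: mulr_ge0; first by rewrite mulr_ge0 ?sqr_ge0.
  apply: addr_ge0; first by apply: divr_ge0 (ltW lam0); rewrite mulr_ge0 ?exprn_ge0 ?(ltW K0).
  by apply: divr_ge0 (ltW mR0); rewrite mulr_ge0 ?exprn_ge0 ?(ltW K0).
have mr := mean_leD (mean_leD (mean_leZ Z0 mZ) (mean_le_cst P A0)) (mean_leZ Mc0 mM).
apply: mean_leW (mean_le_ell2 (mean_leW pw (lexx _) mr)) => //.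
apply: ler_wpM2r; first by rewrite invr_ge0.
have n0 : n.+1%:R != 0 :> R by rewrite pnatr_eq0.
have -> : n.+1%:R * ell2 x phi tau = A by rewrite ell2E mulrA divff ?mul1r.
have -> : 2 ^+ 12 * K ^+ 2 * (num_blocks%:R * (m%:R * (64 * s ^+ 2))) =
  2 ^+ 18 * K ^+ 2 * num_blocks%:R * m%:R * s ^+ 2 by ring.
rewrite lerD2l; set Lg := 1 + ln _.
have Lg0 : 0 <= Lg by rewrite addr_ge0// ln_ge0// ler1n.
set V := K / lam; set W := K ^+ 2 / m%:R ^+ 3.
have V0 : 0 <= V by rewrite divr_ge0 ?(ltW K0) ?(ltW lam0).
have W0 : 0 <= W by rewrite divr_ge0 ?exprn_ge0 ?(ltW K0).
have -> : num_blocks%:R * (4 * s ^+ 2 * (2 ^+ 21 * K / lam +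
    2 ^+ 30 * K ^+ 2 / m%:R ^+ 3)) * (84 * Lg) =
  num_blocks%:R * s ^+ 2 * Lg * (336 * (2 ^+ 21 * V + 2 ^+ 30 * W)).
  by rewrite /V /W; ring.
apply: ler_wpM2l.
  by apply: mulr_ge0 Lg0; apply: mulr_ge0 => //; exact: sqr_ge0.
have -> : 2 ^+ 30 * K / lam + 2 ^+ 39 * K ^+ 2 / m%:R ^+ 3 =
  512 * (2 ^+ 21 * V + 2 ^+ 30 * W) by rewrite /V /W; ring.
apply: ler_wpM2r; last by lra.
by apply: addr_ge0; [apply: mulr_ge0 V0|apply: mulr_ge0 W0]; exact: exprn_ge0.
Qed.

End Risk.

(** * Logarithms, fractional powers and constants *)

Section Arithmetic.
Context {R : realType}.

Lemma ln2_bounds : 1 / 2 <= ln (2 : R) <= 3 / 4.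
Proof.
apply/andP; split.
  rewrite -ler_expR lnK ?posrE//.
  have := expR_ge1Dx (- (1 / 2) : R); have := expRxMexpNx_1 (1 / 2 : R).
  by have := expR_gt0 (1 / 2 : R); nra.
rewrite -ler_expR lnK ?posrE//.
have -> : 3 / 4 = 6%:R * (1 / 8) :> R by field.
rewrite expRM_natl; apply: le_trans (_ : (9 / 8) ^+ 6 <= _); first by lra.
rewrite lerXn2r ?nnegrE ?expR_ge0//.
by have := expR_ge1Dx (1 / 8 : R); lra.
Qed.

(** The hypothesis on [c1] gives [Lam >= 1 - ln 2 + ln n]. Thus the logarithm of the theorem is
    bounded away from 0 and dominates the quantities of order [ln n], whatever [c1] is. *)
Lemma log_bounds (n : nat) (c1 : R) : (0 < n)%N -> 0 < c1 ->
  c1 * n%:R <= n.+1%:R ->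
  let Lam := ln (expR 1 * n.+1%:R / (2 * c1)) in
  [/\ 1 / 4 <= Lam, 1 + ln n.+1%:R <= 7 * Lam & (num_blocks n)%:R <= 28 * Lam].
Proof.
move=> n0 c10 cn Lam.
have /andP[l2 l2'] := ln2_bounds.
have nR : 0 < n%:R :> R by rewrite ltr0n.
have lnn : 0 <= ln n%:R :> R by rewrite ln_ge0// ler1n.
have LamE : 1 / 4 + ln n%:R <= Lam.
  have -> : Lam = 1 + ln (n.+1%:R / (2 * c1)).
    rewrite /Lam -mulrA lnM ?posrE ?expR_gt0//.
      by rewrite expRK.
    by rewrite divr_gt0 ?mulr_gt0 ?ltr0n.
  have : ln (n%:R / 2) <= ln (n.+1%:R / (2 * c1)) :> R.
    rewrite ler_ln ?posrE ?divr_gt0 ?mulr_gt0 ?ltr0n//.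
    rewrite ler_pdivlMr ?mulr_gt0//; lra.
  rewrite ln_div ?posrE//; lra.
have lnn1 : ln n.+1%:R <= 3 / 4 + ln n%:R :> R.
  apply: le_trans (_ : ln (2 * n%:R) <= _).
    rewrite ler_ln ?posrE ?mulr_gt0 ?ltr0n// -natrM ler_nat; nlia.
  by rewrite lnM ?posrE//; lra.
split; [lra|lra|].
have tl : (trunc_log 2 n.+1)%:R * ln 2 <= ln n.+1%:R :> R.
  rewrite mulr_natl -lnXn// ler_ln ?posrE ?exprn_gt0 ?ltr0n// -natrX ler_nat.
  exact: trunc_logP.
rewrite /num_blocks natrD natrM.
have := ler0n R (trunc_log 2 n.+1); nra.
Qed.

Lemma powR_root_expn (a : R) (p q : nat) : 0 <= a -> (0 < q)%N ->
  (a `^ (1 / q%:R)) ^+ p = a `^ (p%:R / q%:R).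
Proof.
move=> a0 q0; rewrite -powR_mulrn ?powR_ge0// -powRrM; congr (_ `^ _).
by rewrite mulrC mulrA mulr1.
Qed.

Lemma powR_root_eq (a b : R) (p q : nat) : 0 <= a -> 0 <= b -> (0 < q)%N ->
  b ^+ q = a ^+ p -> a `^ (p%:R / q%:R) = b.
Proof.
move=> a0 b0 q0 ba; rewrite powRrM powR_mulrn// -ba -powR_mulrn// -powRrM.
by rewrite divff ?powRr1// pnatr_eq0 -lt0n.
Qed.

End Arithmetic.

Lemma num_piecesP (R : realType) (f : R -> R) : pw_affine f ->
  affine_pieces (num_pieces f) f.
Proof.
move=> [_ [k fk]].
have ex : exists k, `[< affine_pieces k f >] by exists k; exact/asboolP.
have [j /asboolP fj jmin] := ex_minnP ex.
have : [set k | affine_pieces k f /\ forall j, affine_pieces j f -> (k <= j)%N]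
    (num_pieces f).
  by apply: xgetPex; exists j; split => // i fi; exact/jmin/asboolP.
by case.
Qed.

(** Makes the infimum over piecewise affine functions range over a nonempty set, and the expected
    loss finite. *)
Lemma pw_affine0 (R : realType) : pw_affine (fun=> 0 : R).
Proof.
split.
  by move=> t a b _ _; rewrite convRE !mulr0 addr0.
exists 1%N, (fun i => i%:R); split => // i _; first by rewrite ltr_nat.
by exists 0, 0 => z _; rewrite mul0r addr0.
Qed.

Section FinalBounds.
Context {R : realType}.

(* The constants of both bounds are absorbed into [2 ^+ 51 * K ^+ 2]; here
   [t] is the fourth root of the logarithm. *)
Lemma pieces_bound_le (K kap k N s t E : R) :
  1 <= K -> 1 / 4 <= t -> 0 <= kap -> kap <= 28 * t ^+ 4 -> 1 <= k -> 0 < N -> 0 <= E ->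
  3 * E + 2 ^+ 29 * K ^+ 2 * kap * k * s ^+ 2 / N <=
  2 ^+ 51 * K ^+ 2 * t ^+ 5 * (E + s ^+ 2 * k `^ (5 / 4) / N).
Proof.
move=> K1 t4 kap0 kapt k1 N0 E0.
have t0 : 0 < t by lra.
have K2 : 1 <= K ^+ 2 by rewrite exprn_ege1.
(* The bound at hand contains the logarithm [t ^+ 4], the goal its power 5/4, which is [t ^+ 5]. *)
have t5 : t ^+ 4 <= 4 * t ^+ 5.
  by rewrite [t ^+ 5]exprS; have : 0 <= t ^+ 4 := exprn_ge0 _ (ltW t0); nra.
have t5' : (1 / 4) ^+ 5 <= t ^+ 5 by rewrite lerXn2r ?nnegrE//; lra.
pose B : R := 2 ^+ 29.
have B1 : 1 <= B by rewrite exprn_ege1// ler1n.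
have BE : 2 ^+ 51 = 2 ^+ 22 * B by rewrite /B; ring.
have kk : k <= k `^ (5 / 4).
  by rewrite -{1}(powRr1 (le_trans ler01 k1)) ler_powR//; lra.
have s0 : 0 <= s ^+ 2 / N by rewrite divr_ge0 ?sqr_ge0 ?ltW.
rewrite mulrDr; apply: lerD.
  apply: ler_wpM2r => //; rewrite BE.
  have : 1 <= B * K ^+ 2 by apply: mulr_ege1.
  rewrite -[2 ^+ 22 * B * _]mulrA; nra.
have -> : 2 ^+ 29 * K ^+ 2 * kap * k * s ^+ 2 / N =
   B * K ^+ 2 * (s ^+ 2 / N) * (kap * k) by rewrite /B; ring.
have -> : 2 ^+ 51 * K ^+ 2 * t ^+ 5 * (s ^+ 2 * k `^ (5 / 4) / N) =
   B * K ^+ 2 * (s ^+ 2 / N) * (2 ^+ 22 * t ^+ 5 * k `^ (5 / 4)).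
  by rewrite BE; ring.
apply: ler_wpM2l.
  by rewrite mulr_ge0// mulr_ge0 ?sqr_ge0//; lra.
apply: ler_pM => //; first lra.
have : 0 <= t ^+ 5 := exprn_ge0 _ (ltW t0); lra.
Qed.

(** This [lam] turns the second term into order [Lg * V] with [V = s ^+ 2 * M * K ^+ 2], and the
    term in [1 / lam] into a multiple of [r ^+ 5 / M ^+ 4 <= M]. As [t <= r <= M], also
    [Lg / M ^+ 3 <= 7 * M]. So all terms are of order [t ^+ 4 * V], and [M <= 2 * r] concludes. *)
Lemma affine_bound_le (K kap Lg N s t r G Rd M lam : R) :
  1 <= K -> 0 < t -> 0 <= kap -> kap <= 28 * t ^+ 4 -> 0 < Lg -> Lg <= 7 * t ^+ 4 ->
  t ^+ 4 <= 4 * t ^+ 5 ->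
  0 < N -> 0 < s -> 0 < Rd -> 0 <= G -> G <= 4 * Rd ^+ 2 ->
  1 <= r -> t <= r -> r ^+ 5 = N * Rd ^+ 2 / s ^+ 2 ->
  r <= M -> M <= 2 * r ->
  lam = Lg * s ^+ 2 * M ^+ 4 / (N * Rd ^+ 2) ->
  (2 ^+ 18 * K ^+ 2 * kap * M * s ^+ 2 +
      2 ^+ 8 * K * lam / M ^+ 3 * (N * G) +
      kap * s ^+ 2 * Lg * (2 ^+ 30 * K / lam + 2 ^+ 39 * K ^+ 2 / M ^+ 3)) / N <=
  2 ^+ 51 * K ^+ 2 * t ^+ 5 * (s ^+ 2 * r / N).
Proof.
move=> K1 t0 kap0 kapt Lg0 Lgt t5 N0 s0 Rd0 G0 GR r1 tr rE rm mr lamE.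
have M1 : 1 <= M by exact: le_trans r1 rm.
have M0 : 0 < M by lra.
have K2 : K <= K ^+ 2 by rewrite expr2 ler_peMl//; lra.
have K0 : 0 < K by lra.
set V := s ^+ 2 * M * K ^+ 2.
have s20 : 0 < s ^+ 2 by rewrite exprn_gt0.
have V0 : 0 <= V by rewrite mulr_ge0 ?sqr_ge0// mulr_ge0// ltW.
have nz : [/\ N != 0, s != 0, Rd != 0, M != 0 & Lg != 0] by split; rewrite gt_eqF.
case: nz => Nn sn Rn Mn Ln.
have e2 : 2 ^+ 8 * K * lam / M ^+ 3 * (N * G) <= 2 ^+ 10 * Lg * V.
  have -> : 2 ^+ 8 * K * lam / M ^+ 3 * (N * G) =
     2 ^+ 8 * K * Lg * s ^+ 2 * M * (G / Rd ^+ 2).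
    by rewrite lamE; field; rewrite Nn Rn Mn.
  have g4 : G / Rd ^+ 2 <= 4 by rewrite ler_pdivrMr ?exprn_gt0.
  have c0 : 0 <= 2 ^+ 8 * K * Lg * s ^+ 2 * M.
    by rewrite !mulr_ge0 ?exprn_ge0 ?(ltW K0) ?(ltW Lg0) ?(ltW s0) ?(ltW M0).
  apply: le_trans (ler_wpM2l c0 g4) _.
  have -> : 2 ^+ 8 * K * Lg * s ^+ 2 * M * 4 = 2 ^+ 10 * Lg * (s ^+ 2 * M * K) by ring.
  apply: ler_wpM2l; first by rewrite mulr_ge0 ?exprn_ge0 ?(ltW Lg0).
  by rewrite /V ler_wpM2l// mulr_ge0 ?sqr_ge0 ?(ltW M0).
have rM := rm.
have tM : t ^+ 4 <= M ^+ 4 by rewrite lerXn2r ?nnegrE ?(ltW t0) ?(ltW M0)//; exact: le_trans tr rM.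
have rM5 : r ^+ 5 <= M ^+ 5 by rewrite lerXn2r ?nnegrE ?(ltW M0)//; lra.
have e3 : kap * s ^+ 2 * Lg * (2 ^+ 30 * K / lam + 2 ^+ 39 * K ^+ 2 / M ^+ 3) <=
    2 ^+ 42 * kap * V.
  have -> : kap * s ^+ 2 * Lg * (2 ^+ 30 * K / lam + 2 ^+ 39 * K ^+ 2 / M ^+ 3) =
      kap * s ^+ 2 * (2 ^+ 30 * K * (r ^+ 5 / M ^+ 4) +
      2 ^+ 39 * K ^+ 2 * (Lg / M ^+ 3)).
    by rewrite rE lamE; field; rewrite Nn sn Rn Mn Ln.
  have h1 : r ^+ 5 / M ^+ 4 <= M by rewrite ler_pdivrMr ?exprn_gt0// -exprS.
  have h2 : Lg / M ^+ 3 <= 7 * M.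
    by rewrite ler_pdivrMr ?exprn_gt0// -mulrA -exprS; lra.
  have k1 : 0 <= 2 ^+ 30 * K by rewrite mulr_ge0 ?exprn_ge0 ?(ltW K0).
  have k2 : 0 <= 2 ^+ 39 * K ^+ 2 by rewrite mulr_ge0 ?exprn_ge0 ?(ltW K0).
  have h := lerD (ler_wpM2l k1 h1) (ler_wpM2l k2 h2).
  have ks : 0 <= kap * s ^+ 2 by rewrite mulr_ge0 ?sqr_ge0.
  apply: le_trans (ler_wpM2l ks h) _.
  have -> : 2 ^+ 42 * kap * V = kap * s ^+ 2 * (2 ^+ 42 * (M * K ^+ 2)).
    by rewrite /V; ring.
  apply: ler_wpM2l => //.
  have : M * K <= M * K ^+ 2 by rewrite ler_wpM2l// ltW.
  have : 0 <= M * K by rewrite mulr_ge0 ?(ltW M0) ?(ltW K0).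
  pose B : R := 2 ^+ 30; have B0 : 0 <= B by rewrite exprn_ge0.
  have -> : 2 ^+ 30 * K * M + 2 ^+ 39 * K ^+ 2 * (7 * M) =
    B * (M * K) + 7 * 512 * (B * (M * K ^+ 2)) by rewrite /B; ring.
  have -> : 2 ^+ 42 * (M * K ^+ 2) = 4096 * (B * (M * K ^+ 2)) by rewrite /B; ring.
  move=> MK MK2.
  have := ler_wpM2l B0 MK2; have := mulr_ge0 B0 MK; lra.
have e1 : 2 ^+ 18 * K ^+ 2 * kap * M * s ^+ 2 = 2 ^+ 18 * kap * V.
  by rewrite /V; ring.
rewrite ler_pdivrMr// e1.
have -> : 2 ^+ 51 * K ^+ 2 * t ^+ 5 * (s ^+ 2 * r / N) * N =
    2 ^+ 51 * (t ^+ 5 * (s ^+ 2 * r * K ^+ 2)) by field.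
have V2 : V <= 2 * (s ^+ 2 * r * K ^+ 2).
  rewrite (_ : 2 * _ = s ^+ 2 * (2 * r) * K ^+ 2); last by ring.
  by rewrite /V ler_wpM2r ?sqr_ge0// ler_wpM2l// ltW.
have pow2 i j : (i <= j)%N -> 2 ^+ i <= 2 ^+ j :> R.
  by move=> ij; rewrite ler_weXn2l// ler1n.
have h18 : 2 ^+ 18 <= 2 ^+ 42 / 64 :> R.
  rewrite ler_pdivlMr// (_ : _ * 64 = 2 ^+ 24) ?pow2//; by ring.
have h10 : 2 ^+ 10 <= 2 ^+ 42 / 64 :> R.
  rewrite ler_pdivlMr// (_ : _ * 64 = 2 ^+ 16) ?pow2//; by ring.
have h51 : 2 ^+ 51 = 512 * 2 ^+ 42 :> R by ring.
have B0 : 0 <= 2 ^+ 42 :> R by rewrite exprn_ge0.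
apply: le_trans (lerD (lerD (lexx _) e2) e3) _; rewrite h51.
have p18 : 0 <= 2 ^+ 18 :> R by rewrite exprn_ge0.
have p10 : 0 <= 2 ^+ 10 :> R by rewrite exprn_ge0.
move: (2 ^+ 42) (2 ^+ 18) (2 ^+ 10) B0 h18 h10 p18 p10 => B A18 A10 B0 h18 h10 p18 p10.
set W := s ^+ 2 * r * K ^+ 2 in V2 *.
have W0 : 0 <= W by lra.
have t40 : 0 <= t ^+ 4 := exprn_ge0 _ (ltW t0).
have c18 : A18 * kap * V <= B / 64 * (28 * t ^+ 4) * V.
  by apply: ler_wpM2r => //; apply: ler_pM.
have c10 : A10 * Lg * V <= B / 64 * (7 * t ^+ 4) * V.
  by apply: ler_wpM2r => //; apply: ler_pM => //; exact: ltW.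
have c42 : B * kap * V <= B * (28 * t ^+ 4) * V.
  by rewrite ler_wpM2r// ler_wpM2l.
have BV : B * t ^+ 4 * V <= B * (4 * t ^+ 5) * (2 * W).
  apply: ler_pM => //; first by rewrite mulr_ge0.
  by rewrite ler_wpM2l.
have BV0 : 0 <= B * t ^+ 4 * V by apply: mulr_ge0 V0; exact: mulr_ge0.
have -> : 512 * B * (t ^+ 5 * W) = 64 * (B * (4 * t ^+ 5) * (2 * W)) by ring.
move: c18 c10 c42.
have -> : B / 64 * (28 * t ^+ 4) * V = 28 / 64 * (B * t ^+ 4 * V) by ring.
have -> : B / 64 * (7 * t ^+ 4) * V = 7 / 64 * (B * t ^+ 4 * V) by ring.
have -> : B * (28 * t ^+ 4) * V = 28 * (B * t ^+ 4 * V) by ring.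
lra.
Qed.

End FinalBounds.

Unset Implicit Arguments.

Theorem theorem2p1 (R : realType) (rho : R) (rho_gt0 : 0 < rho) :
  exists C : R, 0 < C /\
  forall (c1 c2 : R), 0 < c1 -> 0 < c2 -> c1 / c2 = rho ->
  forall (n : nat), (2 <= n)%N ->
  forall (x : 'I_n -> R),
    (forall i, 0 <= x i <= 1) ->
    (forall i j : 'I_n, (i < j)%N -> x i < x j) ->
    (forall i j : 'I_n, nat_of_ord j = (nat_of_ord i).+1 ->
       c1 <= n%:R * (x j - x i) <= c2) ->
  forall (phi0 : R -> R), convex01 phi0 ->
  forall (sigma : R), 0 < sigma ->
  forall (d : measure_display) (T : measurableType d) (P : probability T R)
         (xi : 'I_n -> {RV P >-> R}),
    independent_RVs xi ->
    (forall i, normal_RV 0 sigma (xi i)) ->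
  forall (Y : 'I_n -> T -> R),
    (forall i w, Y i w = phi0 (x i) + xi i w) ->
  forall (phi_ls : T -> R -> R),
    (forall w, is_lse x (fun i => Y i w) (phi_ls w)) ->
  let R0 := Num.max 1 (affine_dist x phi0) in
  let L := (ln (expR 1 * n%:R / (2 * c1))) `^ (5 / 4) in
  C * (sigma ^+ 2 / R0 ^+ 2) * L <= n%:R ->
  ('E_P[fun w => ell2 x (phi_ls w) phi0] <=
    (C * L *
     Num.min ((sigma ^+ 2 * Num.sqrt R0 / n%:R) `^ (4 / 5))
             (inf [set ell2 x phi0 alpha +
                       sigma ^+ 2 * (num_pieces alpha)%:R `^ (5 / 4) / n%:R
                  | alpha in [set alpha | pw_affine alpha]]))%:E)%E.
Proof.
set C0 : R := 2 ^+ 51.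
have C00 : 0 < C0 by rewrite exprn_gt0.
(* Since [K = 1 / rho], this is the [2 ^+ 51 * K ^+ 2] of the two final bounds. *)
exists (C0 / rho ^+ 2); split; first by rewrite divr_gt0// exprn_gt0.
move=> c1 c2 c10 c20 c12 [//|n] n2 x x01 xinc xgap phi0 cphi sigma s0 d T P xi
  ixi nxi Y YE psi lse.
set R0 := Num.max 1 _; set Lam := ln _; move=> R0' L.
have n0 : (0 < n)%N by [].
pose K := c2 / c1.
have C0E : C0 / rho ^+ 2 = C0 * K ^+ 2.
  by rewrite -c12 /K; field; rewrite !gt_eqF.
have c1c2 : c1 <= c2.
  have := xgap ord0 (Ordinal n2) erefl => /andP[h1 h2]; exact: le_trans h2.
have K1 : 1 <= K by rewrite /K ler_pdivlMr// mul1r.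
have K2 : 1 <= K ^+ 2 by rewrite exprn_ege1.
have NR0 : 0 < n.+1%:R :> R by rewrite ltr0n.
(* The [n] gaps, each at least [c1 / n.+1], fit into the unit interval. *)
have cn : c1 * n%:R <= n.+1%:R.
  have : n%:R * (c1 / n.+1%:R) <= \sum_(0 <= i < 0 + n) (design x i.+1 - design x i).
    apply: sum_ge_nat => i /andP[_ ni].
    have := xgap (inord i) (inord i.+1); rewrite !inordK ?ltnS//; last exact: ltnW.
    by move=> /(_ erefl) /andP[h _]; rewrite ler_pdivrMr// mulrC.
  rewrite telescope_sumr// add0n.
  have /andP[_ b1] := x01 (inord n); have /andP[b2 _] := x01 (inord 0).
  rewrite mulrA ler_pdivrMr// mulrC => h; apply: le_trans h _.
  by rewrite ler_piMl ?(ltW NR0)// /design; lra.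
have [Lam4 LgLam kapLam] := log_bounds n0 c10 cn.
rewrite -/Lam in Lam4 LgLam kapLam.
have Lam0 : 0 <= Lam by lra.
pose t := Lam `^ (1 / 4%:R).
have tE : t ^+ 4 = Lam by rewrite powR_root_expn// divff ?powRr1// pnatr_eq0.
have LE : L = t ^+ 5 by rewrite powR_root_expn.
have t0 : 0 <= t := powR_ge0 _ _.
have t4 : 1 / 4 <= t.
  rewrite leNgt; apply/negP => tlt; have : t ^+ 4 <= t ^+ 1.
    by rewrite ler_wiXn2l//; lra.
  rewrite tE expr1; lra.
rewrite -tE in LgLam kapLam.
have R01 : 1 <= R0 by rewrite /R0 le_max lexx.
rewrite -/R0 -/L LE C0E => nbig.
have lse' w : is_lse x (fun i => phi0 (x i) + xi i w) (psi w).
  rewrite (_ : (fun i => _) = fun i => Y i w)//.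
  by apply/funext => i; rewrite YE.
have ell2_ge0 f g : 0 <= ell2 x f g.
  by rewrite /ell2 mulr_ge0 ?invr_ge0// sumr_ge0// => i _; exact: sqr_ge0.
set E := ('E_P[_])%E.
have E_ge0 : (0 <= E)%E by exact: expectation_ge0.
have kap0 : 0 <= (num_blocks n)%:R :> R by [].
have E_pieces al : pw_affine al -> (E <= (C0 * K ^+ 2 * t ^+ 5 *
    (ell2 x phi0 al + sigma ^+ 2 * (num_pieces al)%:R `^ (5 / 4) / n.+1%:R))%:E)%E.
  move=> pal; have kal := num_piecesP pal.
  apply: mean_le_expectation => //.
  apply: mean_leW (mean_le_risk_pieces c10 x01 xgap c1c2 s0 ixi nxi lse' pal.1 kal) => //.
  apply: pieces_bound_le => //.
  by rewrite ler1n (affine_pieces_gt0 kal).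
have E_smooth : (E <= (C0 * K ^+ 2 * t ^+ 5 *
    (sigma ^+ 2 * Num.sqrt R0 / n.+1%:R) `^ (4 / 5))%:E)%E.
  have R0p : 0 < R0 by lra.
  have tp : 0 < t by lra.
  (* A near minimizer is enough: an excess of 1 over the infimum is at most [R0], which gives the
     4. *)
  have [tau [atau tauR]] : exists tau, affine_on `[0, 1]%classic tau /\
      ell2 x phi0 tau <= 4 * R0 ^+ 2.
    have inf_dist : has_inf [set ell x phi0 tau | tau in
        [set tau | affine_on `[0, 1]%classic tau]].
      split; last by exists 0 => _ [tau _ <-]; exact: sqrtr_ge0.
      by eexists; exists (fun=> 0) => //; exists 0, 0 => z _; rewrite mul0r addr0.
    have [_ [tau atau <-] taulE] := inf_adherent ltr01 inf_dist.
    exists tau; split => //.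
    have le2 : ell x phi0 tau <= 2 * R0.
      have : affine_dist x phi0 <= R0 by rewrite /R0 le_max lexx orbT.
      move: taulE; rewrite -/(affine_dist x phi0); lra.
    rewrite -[leLHS]sqr_sqrtr// -/(ell x phi0 tau).
    rewrite (_ : 4 * R0 ^+ 2 = (2 * R0) ^+ 2); last by ring.
    by rewrite lerXn2r ?nnegrE ?sqrtr_ge0//; lra.
  pose a := n.+1%:R * R0 ^+ 2 / sigma ^+ 2.
  have a0 : 0 < a by rewrite divr_gt0 ?mulr_gt0 ?exprn_gt0.
  (* The real number that [m] rounds up; [sigma ^+ 2 * r / n.+1] is exactly the first term of the
     minimum. *)
  pose r := a `^ (1 / 5%:R).
  have r0 : 0 <= r := powR_ge0 _ _.
  have r5 : r ^+ 5 = a.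
    by rewrite powR_root_expn ?(ltW a0)// divff ?powRr1 ?(ltW a0)// pnatr_eq0.
  (* This is the condition on the sample size, weakened by [K ^+ 2 >= 1]; both [t <= r] and [1 <= r]
     follow from it. *)
  have rbig : C0 * t ^+ 5 <= r ^+ 5.
    rewrite r5 /a ler_pdivlMr ?exprn_gt0//.
    have -> : C0 * t ^+ 5 * sigma ^+ 2 = C0 * t ^+ 5 * (sigma ^+ 2 / R0 ^+ 2) * R0 ^+ 2.
      by field; rewrite gt_eqF.
    apply: ler_wpM2r; first exact: sqr_ge0.
    apply: le_trans nbig.
    rewrite (_ : C0 * K ^+ 2 * _ * _ = K ^+ 2 * (C0 * t ^+ 5 * (sigma ^+ 2 / R0 ^+ 2))).
      rewrite ler_peMl// mulr_ge0 ?divr_ge0 ?sqr_ge0//.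
      by rewrite mulr_ge0 ?exprn_ge0// ltW.
    by ring.
  have C01 : 1 <= C0 by rewrite exprn_ege1// ler1n.
  have tr : t <= r.
    rewrite -(@ler_pXn2r _ 5) ?nnegrE//; apply: le_trans rbig.
    by rewrite ler_peMl// exprn_ge0.
  have r1 : 1 <= r.
    rewrite -(@ler_pXn2r _ 5) ?nnegrE// expr1n; apply: le_trans rbig.
    have : (1 / 4) ^+ 5 <= t ^+ 5 by rewrite lerXn2r ?nnegrE//; lra.
    have -> : C0 = 2 ^+ 41 * 4 ^+ 5 by rewrite /C0; ring.
    have : 1 <= 2 ^+ 41 :> R by rewrite exprn_ege1// ler1n.
    move: (2 ^+ 41) => B B1 h.
    have : B * 4 ^+ 5 * (1 / 4) ^+ 5 <= B * 4 ^+ 5 * t ^+ 5.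
      by rewrite ler_wpM2l// mulr_ge0//; lra.
    have -> : B * 4 ^+ 5 * (1 / 4) ^+ 5 = B by field.
    exact: le_trans.
  pose m := (Num.truncn r).+1.
  have mr : r <= m%:R <= 2 * r.
    have := truncn_itv r0; rewrite -/m => /andP[h1 h2].
    by rewrite (ltW h2) /m -addn1 natrD; lra.
  have /andP[mr1 mr2] := mr.
  have Lg0 : 0 < 1 + ln n.+1%:R :> R.
    by rewrite ltr_pwDl// ln_ge0// ler1n.
  pose lam := (1 + ln n.+1%:R) * sigma ^+ 2 * m%:R ^+ 4 / (n.+1%:R * R0 ^+ 2).
  have lam0 : 0 < lam.
    by rewrite divr_gt0 ?mulr_gt0 ?exprn_gt0// ltr0n.
  apply: mean_le_expectation => //.
  apply: mean_leW (mean_le_risk_affine c10 x01 xgap c1c2 s0 ixi nxi lse' n0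
    (ltn0Sn _ : 0 < m)%N lam0 cphi atau) => //.
  have -> : (sigma ^+ 2 * Num.sqrt R0 / n.+1%:R) `^ (4 / 5) =
      sigma ^+ 2 * r / n.+1%:R.
    apply: (@powR_root_eq _ _ _ 4 5) => //.
    - apply: divr_ge0 (ltW NR0); apply: mulr_ge0 (sqrtr_ge0 _); exact: sqr_ge0.
    - by apply: divr_ge0 (ltW NR0); apply: mulr_ge0 r0; exact: sqr_ge0.
    have -> : (sigma ^+ 2 * Num.sqrt R0 / n.+1%:R) ^+ 4 =
        sigma ^+ 8 * (Num.sqrt R0 ^+ 2) ^+ 2 / n.+1%:R ^+ 4 by field.
    rewrite sqr_sqrtr ?(ltW R0p)//.
    have -> : (sigma ^+ 2 * r / n.+1%:R) ^+ 5 =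
        sigma ^+ 10 * r ^+ 5 / n.+1%:R ^+ 5 by field.
    rewrite r5 /a.
    have : n.+1%:R != 0 :> R by rewrite gt_eqF.
    move: (n.+1%:R) => N N0; field.
    by rewrite N0 gt_eqF.
  apply: (affine_bound_le (Lg := 1 + ln n.+1%:R) (Rd := R0) (M := m%:R)) => //.
  by rewrite [t ^+ 5]exprS; have : 0 <= t ^+ 4 := exprn_ge0 _ t0; nra.
have CL0 : 0 < C0 * K ^+ 2 * t ^+ 5.
  apply: mulr_gt0; last by rewrite exprn_gt0//; lra.
  by apply: mulr_gt0 => //; exact: lt_le_trans ltr01 K2.
rewrite /Num.min; case: ifP => _; first exact: E_smooth.
set S := [set _ | _ in _].
(* The bound for the zero function makes [E] finite, so that its quotient by the constant is a real
   lower bound of the set under the infimum. *)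
have [v vE] : exists v, E = v%:E.
  have Efin : E \is a fin_num.
    rewrite ge0_fin_numE//; apply: le_lt_trans (E_pieces _ (pw_affine0 R)) _.
    exact: ltry.
  by exists (fine E); rewrite fineK.
rewrite vE lee_fin mulrC -ler_pdivrMr//; apply: lb_le_inf.
  by eexists; exists (fun=> 0); [exact: pw_affine0|].
move=> _ [al pal <-]; rewrite ler_pdivrMr// mulrC -lee_fin -vE.
exact: E_pieces.
Qed.
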